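(* Let $Q$ be a nonzero quadratic form on $\mathbb{F}_{q_1}/\mathbb{F}_q$ with rank $r_Q$, and let $\mathcal{C}_{Q,N}'$ be the $\mathbb{F}_p$-linear code obtained by descending $\mathcal{C}_Q'$ (as described in the context). For each $r$ with $1\le r\le m(m_2+2)$: (1) if $r_Q$ is even and $\epsilon=1$, then $d_r(\mathcal{C}_{Q,N}')=\frac{q^M(q-1)}{p^rN}(p^r-1)(1-q^{-r_Q/2})$ for $1\le r\le m$; $d_r(\mathcal{C}_{Q,N}')=\frac{q^M(q-1)}{p^rN}\bigl(p^r-1-q^{-r_Q/2}(q-1)\bigr)$ for $m<r\le m(m_2+1)$; $d_r(\mathcal{C}_{Q,N}')=\frac{q^M}{p^rN}\bigl(p^r(q-1)-(q-p^{r-m(m_2+1)})(1+q^{-r_Q/2}(q-1))\bigr)$ for $r>m(m_2+1)$; (2) if $r_Q$ is even and $\epsilon=-1$, then $d_r(\mathcal{C}_{Q,N}')=\frac{q^M}{p^rN}(p^r-1)(q-1-q^{-r_Q/2})$ for $1\le r\le m$; $d_r(\mathcal{C}_{Q,N}')=\frac{q^M(q-1)}{p^rN}(p^r-1-q^{-r_Q/2})$ for $m<r\le m(m_2+1)$; $d_r(\mathcal{C}_{Q,N}')=\frac{q^M}{p^rN}\bigl(p^r(q-1)-(q-p^{r-m(m_2+1)})(1+q^{-r_Q/2})\bigr)$ for $r>m(m_2+1)$; (3) if $r_Q$ is odd, then $d_r(\mathcal{C}_{Q,N}')=\frac{q^M}{p^rN}(p^r-1)(q-1-q^{(1-r_Q)/2})$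 for $1\le r\le m$; $d_r(\mathcal{C}_{Q,N}')=\frac{q^M(q-1)}{p^rN}(p^r-1-q^{(1-r_Q)/2})$ for $m<r\le m(m_2+1)$; $d_r(\mathcal{C}_{Q,N}')=\frac{q^M}{p^rN}\bigl(p^r(q-1)-(q-p^{r-m(m_2+1)})(1+q^{(1-r_Q)/2})\bigr)$ for $r>m(m_2+1)$.
   Context: Let $p$ be an odd prime, $m\ge1$, $q=p^m$. Let $m_1,m_2$ be positive integers, $M=m_1+m_2$, $q_i=q^{m_i}$, $\mathbb{F}=\mathbb{F}_{q_1}\times\mathbb{F}_{q_2}$. $\mathrm{Tr}_{q^s/q}$ is the trace $\mathbb{F}_{q^s}\to\mathbb{F}_q$; $\eta$ is the quadratic character of $\mathbb{F}_q$ with $\eta(0)=0$. A quadratic form $Q$ on $\mathbb{F}_{q_1}/\mathbb{F}_q$ is a map $Q:\mathbb{F}_{q_1}\to\mathbb{F}_q$ with $Q(ax)=a^2Q(x)$ ($a\in\mathbb{F}_q$) such that $B_Q(x,y)=\frac12(Q(x+y)-Q(x)-Q(y))$ is $\mathbb{F}_q$-bilinear; rank $r_Q=m_1-\dim_{\mathbb{F}_q}\{x:B_Q(x,y)=0\ \forall y\}$; in suitable coordinates $Q=\sum_{i=1}^{r_Q}\lambda_ix_i^2$, $\lambda_i\in\mathbb{F}_q^*$, $\varepsilon_Q=\eta(\lambda_1\cdots\lambda_{r_Q})$. $\epsilon=\varepsilon_Q(-1)^{(p-1)mr_Q/4}$ if $r_Q$ even, $\epsilon=\varepsilon_Q(-1)^{(p-1)m(r_Q+1)/4}$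 if $r_Q$ odd. Let $\mathcal{C}_Q'=\{(aQ(x)+\mathrm{Tr}_{q_2/q}(by)+c)_{(x,y)\in\mathbb{F}}:(a,b,c)\in\mathbb{F}_q\times\mathbb{F}_{q_2}\times\mathbb{F}_q\}$, of length $n'=q^M$. Let $N$ be a positive divisor of $p-1$ with $\gcd(N,\frac{q-1}{p-1})=1$, and $\theta$ a primitive $\frac{q-1}{N}$-th root of unity in $\mathbb{F}_q$. For $\gamma\in\mathbb{F}_q$ let $\psi_\gamma=(\mathrm{Tr}_{q/p}(\gamma\theta^i))_{0\le i<\frac{q-1}{N}}\in\mathbb{F}_p^{(q-1)/N}$. Define $\mathcal{C}_{Q,N}'=\{(\psi_{c_1},\dots,\psi_{c_{n'}}):(c_1,\dots,c_{n'})\in\mathcal{C}_Q'\}\subseteq\mathbb{F}_p^{n'(q-1)/N}$ (concatenation). For a linear code $\mathcal{C}$ over $\mathbb{F}_p$ of dimension $k$ and $1\le r\le k$, $d_r(\mathcal{C})$ is the minimum of $\#\mathrm{Supp}(K)$ over $r$-dimensional $\mathbb{F}_p$-subspaces $K\subseteq\mathcal{C}$, where $\mathrm{Supp}(K)$ is the set of coordinates where some codeword of $K$ is nonzero. *)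

(* Defs.v *)
From mathcomp Require Import all_boot all_order all_algebra all_field.
Set Implicit Arguments. Unset Strict Implicit. Unset Printing Implicit Defensive.
Import GRing.Theory.
Local Open Scope ring_scope.

(* Relative trace Tr_{q^s/q} : L -> K, where K = F_q is embedded in L = F_{q^s}
   by the field embedding [iota]; Tr(y) = sum_{i<s} y^(q^i), which lies in
   (the image of) K; we return its unique preimage. *)
Definition rel_trace (K L : finFieldType) (iota : {rmorphism K -> L}) (s : nat)
    (y : L) : K :=
  odflt 0 [pick a : K | iota a == \sum_(i < s) y ^+ (#|K| ^ i)].

(* Absolute trace Tr_{q/p} : F_q -> F_p (q = p^m), Tr(x) = sum_{i<m} x^(p^i),
   which lies in the prime field; returned as an element of 'F_p. *)
Definition abs_trace (p m : nat) (K : finFieldType) (x : K) : 'F_p :=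
  odflt 0 [pick k : 'F_p | ((k : nat)%:R : K) == \sum_(i < m) x ^+ (p ^ i)].

Definition qchar (K : finFieldType) (x : K) : int :=
  if x == 0 then 0 else if [exists y : K, y ^+ 2 == x] then 1 else -1.

Definition qf_bilin (K L : finFieldType) (Q : L -> K) (x y : L) : K :=
  (Q (x + y) - Q x - Q y) / 2%:R.

Definition is_quadratic_form (K L : finFieldType) (iota : {rmorphism K -> L})
    (Q : L -> K) : Prop :=
  (forall (a : K) (x : L), Q (iota a * x) = a ^+ 2 * Q x) /\
  (forall (a b : K) (x y z : L),
      qf_bilin Q (iota a * x + iota b * y) z
        = a * qf_bilin Q x z + b * qf_bilin Q y z) /\
  (forall (a b : K) (x y z : L),
      qf_bilin Q z (iota a * x + iota b * y)
        = a * qf_bilin Q z x + b * qf_bilin Q z y).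

(* Index set of the coordinates of C'_{Q,N}: ((x,y), i) with (x,y) in F and
   0 <= i < n, n = (q-1)/N. *)
Definition idx (L1 L2 : finFieldType) (n : nat) : finType :=
  ((L1 * L2) * 'I_n)%type.

Definition desc_code (p m m2 n : nat) (K L1 L2 : finFieldType)
    (iota2 : {rmorphism K -> L2}) (Q : L1 -> K) (theta : K)
    (v : {ffun idx L1 L2 n -> ('F_p)^o}) : Prop :=
  exists (a : K) (b : L2) (c : K),
    forall (x : L1) (y : L2) (i : 'I_n),
      v ((x, y), i) =
        abs_trace p m ((a * Q x + rel_trace iota2 m2 (b * y) + c) * theta ^+ i).

Definition supp (p : nat) (I : finType) (U : {vspace {ffun I -> ('F_p)^o}})
    : {set I} :=
  [set j : I | [exists v : {ffun I -> ('F_p)^o}, (v \in U) && (v j != 0)]].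

Definition is_ghw (p : nat) (I : finType) (C : {ffun I -> ('F_p)^o} -> Prop)
    (r d : nat) : Prop :=
  (exists U : {vspace {ffun I -> ('F_p)^o}},
      \dim U = r /\ (forall v, v \in U -> C v) /\ #|supp U| = d) /\
  (forall U : {vspace {ffun I -> ('F_p)^o}},
      \dim U = r -> (forall v, v \in U -> C v) -> (d <= #|supp U|)%N).

Definition ghw_eq (p : nat) (I : finType) (C : {ffun I -> ('F_p)^o} -> Prop)
    (r : nat) (x : rat) : Prop :=
  exists d : nat, is_ghw C r d /\ (d%:R : rat) = x.

(* Main.v *)
(** The trace pairing identifies K x L2 x K with its F_p-dual, and every coordinate
    ((x, y), i) of the descended code is evaluation at the vector
    (theta^i Q(x), theta^i y, theta^i). An r-dimensional subcode thus corresponds to its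
    annihilator V, a subgroup with q^(m2+2) / p^r elements. Because gcd(N, (q-1)/(p-1)) = 1,
    the powers of theta times F_p^* cover K^* evenly, so that N times the size of the support is
    q^M (q-1) - sum of #Q^-1(u/z) over the (u, w, z) in V with z != 0, and the problem is to
    maximize this weight over V.

    The fibre sizes are q^(m1-1) plus a multiple of [q [t = 0] - 1] (even rank) or of
    eta(delta t) (odd rank). If a is a point with the largest fibre, the maximum is attained at
    V = {(u, w, z) | u - a z in W, w in W2, z in W3}. For r > m it suffices to bound every fibre
    by the largest one. For r <= m and even rank one compares the slices u = 0 and z = 0 of V;
    for odd rank one bounds the sum of eta(u) eta(z) over V by Cauchy-Schwarz on its cosets. *)

From HB Require Import structures.
Require Import Defs.
From mathcomp Require Import all_boot all_order all_algebra all_fingroup all_solvable all_field.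
From mathcomp Require Import zify ring lra.
Set Implicit Arguments. Unset Strict Implicit. Unset Printing Implicit Defensive.
Import Order.TTheory GRing.Theory Num.Theory.
Local Open Scope ring_scope.

(** * Quadratic character sums and diagonal quadratic equations *)

Section QuadraticCharacter.

Variable K : finFieldType.

Lemma finField_prim_root : exists g : K, #|K|.-1.-primitive_root g.
Proof.
have q1 : (1 < #|K|)%N by apply: finNzRing_gt1.
have := @has_prim_root K #|K|.-1 (enum [pred x : K | x != 0]).
case/(_ _ _ _ _)/hasP; first by lia.
- apply/allP => x; rewrite mem_enum unity_rootE inE => x0.
  apply/eqP/(mulfI x0); rewrite -exprS mulr1 prednK ?expf_card //; lia.
- exact: enum_uniq.
- by rewrite -cardE -(cardC1 (0 : K)); apply/eq_leq/eq_card.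
by move=> g _ pg; exists g.
Qed.

Lemma mulrn_card (x : K) : x *+ #|K| = 0.
Proof. by rewrite -FinRing.zmodXgE -cardsT expg_cardG ?inE. Qed.

Hypothesis oddK : odd #|K|.

Lemma odd_two_neq0 : 2%:R != 0 :> K.
Proof.
apply/eqP => two0; have := mulrn_card 1.
rewrite -(odd_double_half #|K|) oddK -muln2 mulrnDr mulnC mulrnA two0 mul0rn.
by move/eqP; rewrite addr0 oner_eq0.
Qed.

Lemma qcharP (x : K) : [\/ qchar x = 0, qchar x = 1 | qchar x = -1].
Proof.
by rewrite /qchar; case: eqP => _; [apply: Or31 | case: ifP => _; [apply: Or32 | apply: Or33]].
Qed.

(** In odd characteristic 0, 1 and -1 stay distinct, so identities between values of [qchar] can be
    checked in K, where Euler's criterion turns them into powers. *)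
Lemma sign_intr_inj (u v : int) :
  [\/ u = 0, u = 1 | u = -1] -> [\/ v = 0, v = 1 | v = -1] ->
  u%:~R = v%:~R :> K -> u = v.
Proof.
have n11 : (1 : K) <> -1.
  by move/eqP; rewrite -addr_eq0 -(mulr2n 1) (negPf odd_two_neq0).
have n01 : (0 : K) <> 1 by move/esym/eqP; rewrite oner_eq0.
have n0N1 : (0 : K) <> -1 by move/esym/eqP; rewrite oppr_eq0 oner_eq0.
by do 2![case=> ->] => //; rewrite ?mulrN1z ?mulr1z ?mulr0z // => /esym.
Qed.

Lemma prim_half g : #|K|.-1.-primitive_root g -> g ^+ (#|K|.-1 %/ 2) = -1 :> K.
Proof.
move=> pg; have q1 : (1 < #|K|)%N by apply: finNzRing_gt1.
have : (g ^+ (#|K|.-1 %/ 2)) ^+ 2 == 1.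
  rewrite -exprM divnK ?(prim_expr_order pg) //.
  by rewrite dvdn2 -subn1 oddB ?oddK; lia.
rewrite sqrf_eq1 => /orP[|/eqP//].
rewrite -(prim_order_dvd pg) => /dvdn_leq; lia.
Qed.

Lemma euler_criterion (x : K) : (qchar x)%:~R = x ^+ (#|K|.-1 %/ 2).
Proof.
have q1 : (1 < #|K|)%N by apply: finNzRing_gt1.
have h2 : (2 * (#|K|.-1 %/ 2) = #|K|.-1)%N.
  by rewrite mulnC divnK // dvdn2 -subn1 oddB ?oddK; lia.
rewrite /qchar; case: eqP => [->|/eqP x0]; first by rewrite expr0n; case: eqP => //; lia.
have xq (y : K) : y != 0 -> y ^+ #|K|.-1 = 1.
  move=> y0; apply/(mulfI y0); rewrite -exprS mulr1 prednK ?expf_card //; lia.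
case: existsP => [[y /eqP yx]|nsq].
  rewrite -yx -exprM h2 xq //; apply: contraNneq x0 => y0.
  by rewrite -yx y0 expr0n.
have [g pg] := finField_prim_root.
have [i xi] := prim_rootP pg (xq x x0).
(* For even i the element g^(i/2) would be a square root of x. *)
have oi : odd i.
  apply: contra_notT nsq => ei; exists (g ^+ (i %/ 2)).
  by rewrite -exprM divnK ?dvdn2 // xi.
by rewrite xi -exprM mulnC exprM prim_half // -signr_odd oi.
Qed.

Lemma qcharM (x y : K) : qchar (x * y) = qchar x * qchar y.
Proof.
apply: sign_intr_inj; first exact: qcharP.
  by case: (qcharP x) => ->; case: (qcharP y) => ->;
    rewrite ?mul0r ?mulr0 ?mul1r ?mulr1 ?mulrNN; constructor.
by rewrite intrM !euler_criterion exprMn.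
Qed.

(** Rational values let character sums mix with cardinalities and divisions by q. *)
Definition eta (x : K) : rat := (qchar x)%:~R.

Lemma etaM x y : eta (x * y) = eta x * eta y.
Proof. by rewrite /eta qcharM intrM. Qed.

Lemma eta0 : eta 0 = 0.
Proof. by rewrite /eta /qchar eqxx. Qed.

Lemma eta_sqr x : x != 0 -> eta (x ^+ 2) = 1.
Proof.
rewrite /eta /qchar expf_eq0 /= => /negPf->.
by case: existsP => // -[]; exists x.
Qed.

Lemma eta1 : eta 1 = 1.
Proof. by rewrite -(expr1n _ 2) eta_sqr ?oner_eq0. Qed.

Lemma eta_mulss x : x != 0 -> eta x * eta x = 1.
Proof. by move=> x0; rewrite -etaM -expr2 eta_sqr. Qed.

Lemma eta_eq0 x : (eta x == 0) = (x == 0).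
Proof.
apply/eqP/eqP => [ex|->]; last exact: eta0.
apply/eqP/contraT => x0; have /eqP := eta_mulss x0.
by rewrite ex mul0r eq_sym oner_eq0.
Qed.

Lemma etaV x : eta x^-1 = eta x.
Proof.
have [->|x0] := eqVneq x 0; first by rewrite invr0.
have exN : eta x != 0 by rewrite eta_eq0.
by apply: (mulfI exN); rewrite -etaM mulfV // eta1 eta_mulss.
Qed.

Lemma qcharN1 : qchar (-1 : K) = (-1) ^+ (#|K|.-1 %/ 2).
Proof.
apply: sign_intr_inj; first exact: qcharP.
  by rewrite -signr_odd; case: odd; rewrite ?expr1 ?expr0; constructor.
by rewrite euler_criterion rmorphXn rmorphN1.
Qed.

(** Multiplication by a generator, on which eta is -1, permutes the terms and negates the sum. *)
Lemma sum_eta : \sum_x eta x = 0.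
Proof.
have [g pg] := finField_prim_root.
have eg : eta g = -1.
  rewrite /eta (sign_intr_inj (qcharP g) (v := -1)) //; first by constructor.
  by rewrite euler_criterion prim_half.
have g0 : g != 0 by rewrite -eta_eq0 eg.
have : \sum_x eta x = - \sum_x eta x.
  rewrite {1}(reindex_inj (mulfI g0)) /= -sumrN; apply: eq_bigr => x _.
  by rewrite etaM eg mulN1r.
by lra.
Qed.

Local Notation q := (#|K|%:R : rat).

(** The classical function v(t) in the solution counts of quadratic equations in an even number of
    variables. *)
Definition nu (t : K) : rat := if t == 0 then q - 1 else -1.

Lemma nuE t : nu t = (t == 0)%:R * q - 1.
Proof. by rewrite /nu; case: eqP => _; rewrite ?mul1r // mul0r sub0r. Qed.

Lemma sum_nu : \sum_t nu t = 0.
Proof.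
under eq_bigr do rewrite nuE.
rewrite sumrB sumr_const -mulr_suml (bigD1 0) //= eqxx big1 => [|i /negPf->//].
by rewrite addr0 mul1r subrr.
Qed.

(** For u != 0 the term equals eta(1 + d/u). If d != 0, then 1 + d/u runs over all elements except
    1, which leaves 0 - eta(1) = -1. *)
Lemma autocorrelation_eta d : \sum_u eta u * eta (u + d) = nu d.
Proof.
rewrite (bigD1 0) //= eta0 mul0r add0r /nu; case: eqP => [->|/eqP d0].
  rewrite (eq_bigr (fun=> 1)) => [|u u0]; last by rewrite addr0 eta_mulss.
  rewrite sumr_const (_ : #|_| = #|K|.-1); last by rewrite -(cardC1 (0 : K)); apply: eq_card.
  rewrite -subn1 natrB //.
  by apply/card_gt0P; exists 0.
have -> : \sum_(i | i != 0) eta i * eta (i + d) = \sum_(i | i != 0) eta (1 + d / i).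
  by apply: eq_bigr => u u0; rewrite -[eta u]etaV -etaM mulrDr mulVf // mulrC.
have eta_sum := sum_eta; rewrite (bigD1 1) //= eta1 in eta_sum.
transitivity (\sum_(i | i != 1) eta i); last by lra.
rewrite [RHS](reindex_onto (fun u => 1 + d / u) (fun s => d / (s - 1))) /=.
  apply: eq_bigl => u /=; have e : 1 + d / u - 1 = d / u by ring.
  rewrite -[_ == 1]subr_eq0 e.
  have [->|u0] := eqVneq u 0; first by rewrite invr0 !mulr0 eqxx.
  by rewrite mulf_neq0 ?invr_eq0 //= invf_div mulrC divfK ?eqxx.
by move=> s s1; rewrite invf_div mulrC divfK ?subr_eq0 // addrC subrK.
Qed.

Lemma convolution_eta t : \sum_s eta s * eta (t - s) = eta (-1) * nu t.
Proof.
rewrite -autocorrelation_eta (reindex_inj oppr_inj) mulr_sumr /=.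
by apply: eq_bigr => s _; rewrite opprK -[- s]mulN1r etaM [t + s]addrC mulrA.
Qed.

Lemma sum_eta_shift t : \sum_s eta (t - s) = 0.
Proof.
rewrite (reindex_inj (h := fun s => t - s)) /=; last by move=> u v /addrI/oppr_inj.
by under eq_bigr do rewrite subKr; apply: sum_eta.
Qed.

Lemma card_sqrt (s : K) : #|[set x : K | x ^+ 2 == s]|%:R = 1 + eta s :> rat.
Proof.
have [->|s0] := eqVneq s 0.
  rewrite eta0 (_ : [set x | _] = [set 0]) ?cards1 //.
  by apply/setP => x; rewrite !inE expf_eq0.
rewrite /eta /qchar (negPf s0); case: existsP => [[y /eqP ys]|ns]; last first.
  rewrite (_ : [set x | _] = set0) ?cards0 ?addrN //.
  by apply/setP => x; rewrite !inE; apply/negP => xs; apply: ns; exists x.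
have y0 : y != 0 by apply: contraNneq s0 => y0; rewrite -ys y0 expr0n.
have yNy : y != - y.
  by rewrite -addr_eq0 -mulr2n -mulr_natl mulf_neq0 ?odd_two_neq0.
rewrite (_ : [set x | _] = [set y; -y]) ?cards2.
  by rewrite yNy.
by apply/setP => x; rewrite !inE -ys eqf_sqr.
Qed.

Lemma sum_scaled_sqr (F : K -> rat) (l : K) : l != 0 ->
  \sum_x F (l * x ^+ 2) = \sum_s F s * (1 + eta (l * s)).
Proof.
move=> l0; rewrite (partition_big (fun x => l * x ^+ 2) xpredT) //=.
apply: eq_bigr => s _; rewrite (eq_bigr (fun=> F s)) => [|x /eqP-> //].
rewrite sumr_const -mulr_natr; congr (_ * _).
rewrite -[l in RHS]invrK etaM etaV -etaM -card_sqrt; congr (_ %:R).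
apply: eq_card => x; rewrite !inE; apply/eqP/eqP => [<-|->]; first by rewrite mulKf.
by rewrite mulVKf.
Qed.

(** The coefficients form a sequence over all of nat, so that induction on n keeps the same
    [lam]. *)
Definition nsol n (lam : nat -> K) (t : K) : rat :=
  #|[set c : {ffun 'I_n -> K} | \sum_(i < n) lam i * c i ^+ 2 == t]|%:R.

Lemma nsol0 lam t : nsol 0 lam t = (t == 0)%:R.
Proof.
rewrite /nsol; have [->|t0] := eqVneq t 0.
  rewrite (eq_card (B := predT)) ?card_ffun ?card_ord ?expn0 // => c.
  by rewrite !inE big_ord0 eqxx.
rewrite (eq_card (B := pred0)) ?card0 // => c.
by rewrite !inE big_ord0 eq_sym (negPf t0).
Qed.

Lemma nsolS n lam t : nsol n.+1 lam t = \sum_x nsol n lam (t - lam n * x ^+ 2).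
Proof.
rewrite /nsol -natr_sum; congr (_ %:R).
rewrite -sum1_card (partition_big (fun c : {ffun 'I_n.+1 -> K} => c ord_max) xpredT) //=.
apply: eq_bigr => x _; rewrite -sum1_card.
pose ext (c : {ffun 'I_n -> K}) : {ffun 'I_n.+1 -> K} :=
  [ffun i => if unlift ord_max i is Some j then c j else x].
pose res (c : {ffun 'I_n.+1 -> K}) := [ffun j : 'I_n => c (lift ord_max j)].
have resK c : res (ext c) = c by apply/ffunP => j; rewrite !ffunE liftK.
rewrite (reindex_onto ext res) /=.
  apply: eq_bigl => c; rewrite !inE resK eqxx andbT ffunE unlift_none eqxx andbT.
  rewrite big_ord_recr /= ffunE unlift_none [RHS]eq_sym subr_eq [RHS]eq_sym.
  congr (_ + _ == _).
  apply: eq_bigr => i _; rewrite (_ : widen_ord _ i = lift ord_max i) ?ffunE ?liftK ?lift_max //.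
  by apply: ord_inj; rewrite lift_max.
move=> c /andP[_ /eqP cx]; apply/ffunP => i; rewrite ffunE.
by case: unliftP => [j ->|->]; rewrite ?ffunE.
Qed.

Lemma nsolS_neq0 n lam t : lam n != 0 ->
  nsol n.+1 lam t = \sum_s nsol n lam (t - s) * (1 + eta (lam n * s)).
Proof. by move=> l0; rewrite nsolS (sum_scaled_sqr (fun s => nsol n lam (t - s))). Qed.

Lemma nsolS_eq0 n lam t : lam n = 0 -> nsol n.+1 lam t = q * nsol n lam t.
Proof.
move=> l0; rewrite nsolS; under eq_bigr do rewrite l0 mul0r subr0.
by rewrite sumr_const mulr_natl.
Qed.

(** The signed discriminant, whose sign collects the factors eta(-1) produced by convolutions of eta
    with itself. *)
Definition disc (lam : nat -> K) n := (-1) ^+ (n %/ 2) * \prod_(i < n) lam i.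

Lemma sum_nu_shift t : \sum_s nu (t - s) = 0.
Proof.
rewrite (reindex_inj (h := fun s => t - s)) /=; last by move=> u v /addrI/oppr_inj.
by under eq_bigr do rewrite subKr; apply: sum_nu.
Qed.

Lemma natr_card_neq0 : q != 0.
Proof. by rewrite pnatr_eq0 -lt0n; apply/card_gt0P; exists 0. Qed.

(** By induction, a new variable convolves the count with 1 + eta(lam_n s). From odd to even n, eta
    convolved with eta gives eta(-1) nu; from even to odd, nu convolved with eta gives q eta. The
    even formula is divided by q, rather than written with exponents lowered by one, so that it also
    covers n = 0. *)
Lemma nsol_nondeg lam n t : (forall i, (i < n)%N -> lam i != 0) ->
  nsol n lam t =
    if odd n then q ^+ n.-1 + q ^+ (n %/ 2) * eta (disc lam n * t)
    else (q ^+ n + q ^+ (n %/ 2) * eta (disc lam n) * nu t) / q.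
Proof.
have qn := natr_card_neq0.
elim: n t => [|n IHn] t nz.
  by rewrite nsol0 /disc big_ord0 div0n !expr0 mulr1 !mul1r eta1 mul1r nuE; field.
have ln : lam n != 0 by apply: nz.
rewrite nsolS_neq0 //; under eq_bigr => s _.
  rewrite IHn => [|i /ltnW]; last exact: nz.
  over.
rewrite /disc big_ord_recr /=; case: (boolP (odd n)) => [on|en] /=.
  have -> : (n.+1 %/ 2 = (n %/ 2).+1)%N by rewrite !divn2 /= uphalf_half on.
  rewrite (eq_bigr (fun s => q ^+ n.-1 + q ^+ n.-1 * eta (lam n) * eta s
      + q ^+ (n %/ 2) * eta ((-1) ^+ (n %/ 2)) * eta (\prod_(i < n) lam i) * eta (t - s)
      + q ^+ (n %/ 2) * eta ((-1) ^+ (n %/ 2)) * eta (\prod_(i < n) lam i) * eta (lam n)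
        * (eta s * eta (t - s)))); last by move=> s _; rewrite !etaM; ring.
  rewrite !big_split /= -!mulr_sumr sum_eta sum_eta_shift convolution_eta sumr_const.
  rewrite !etaM [(-1) ^+ _.+1]exprS etaM [q ^+ (n %/ 2).+1]exprS -mulr_natr.
  (* Since n is odd it is a successor, which gives [n.-1] its true value. *)
  by case: n on {IHn nz ln} => // n _; rewrite /= !exprS; field.
have -> : (n.+1 %/ 2 = (n %/ 2))%N by rewrite !divn2 /= uphalf_half (negPf en).
rewrite (eq_bigr (fun s => q ^+ n / q + q ^+ n / q * eta (lam n) * eta s
    + q ^+ (n %/ 2) * eta ((-1) ^+ (n %/ 2)) * eta (\prod_(i < n) lam i) / q * nu (t - s)
    + q ^+ (n %/ 2) * eta ((-1) ^+ (n %/ 2)) * eta (\prod_(i < n) lam i) / q * eta (lam n)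
      * (nu (t - s) * eta s))); last by move=> s _; rewrite !etaM; field.
rewrite !big_split /= -!mulr_sumr sum_eta sum_nu_shift sumr_const.
(* The constant part of nu is killed by the vanishing sum of eta; only s = t survives. *)
have -> : \sum_s nu (t - s) * eta s = q * eta t.
  under eq_bigr do rewrite nuE mulrBl mul1r.
  rewrite sumrB sum_eta subr0 (bigD1 t) //= big1 => [|s st].
    by rewrite subrr eqxx mul1r addr0.
  by rewrite subr_eq0 eq_sym (negPf st) !mul0r.
by rewrite !etaM -mulr_natr; field.
Qed.

Lemma nsol_degenerate lam n k t :
  (forall i, (n <= i)%N -> lam i = 0) -> nsol (n + k) lam t = q ^+ k * nsol n lam t.
Proof.
move=> l0; elim: k => [|k IHk]; first by rewrite addn0 expr0 mul1r.
by rewrite addnS nsolS_eq0 ?l0 ?leq_addr // IHk exprS mulrA.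
Qed.

End QuadraticCharacter.

(** * Traces of finite fields *)

Section RelativeTrace.

Variables (K L : finFieldType) (iota : {rmorphism K -> L}) (s : nat).
Hypotheses (s_gt0 : (0 < s)%N) (cardL : #|L| = (#|K| ^ s)%N).

Local Notation Tr := (rel_trace iota s).

Lemma expr_card_powD (x y : L) i :
  (x + y) ^+ (#|K| ^ i) = x ^+ (#|K| ^ i) + y ^+ (#|K| ^ i).
Proof.
have [p pr_p pK] := finPcharP K.
have pL : p \in [pchar L] by rewrite (fmorph_pchar iota).
apply: exprDn_pchar; rewrite (eq_pnat _ (pcharf_eq pL)) pnatX.
by have := pprimeChar_pgroup pK; rewrite /pgroup cardsT => ->.
Qed.

(** The q elements of the image of K are already roots of X^q - X; one root more would exceed its
    degree. *)
Lemma fixed_in_subfield (z : L) : z ^+ #|K| = z -> exists a, iota a = z.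
Proof.
move=> zq; have q1 : (1 < #|K|)%N by apply: finNzRing_gt1.
case: (boolP [exists a, iota a == z]) => [/existsP[a /eqP]|]; first by exists a.
rewrite negb_exists => /forallP nz.
have sX : size ('X^#|K| - 'X : {poly L}) = #|K|.+1.
  by rewrite size_polyDl ?size_polyXn // size_polyN size_polyX.
have := @max_poly_roots _ ('X^#|K| - 'X) (z :: map iota (enum K)).
rewrite sX /= size_map -cardE ltnn => H; suff: false by [].
apply: H; first by rewrite -size_poly_eq0 sX.
- rewrite rootE !hornerE zq subrr eqxx /=; apply/allP => _ /mapP[a _ ->].
  by rewrite rootE !hornerE -rmorphXn expf_card subrr.
rewrite map_inj_uniq ?enum_uniq ?andbT; last exact: fmorph_inj.
by apply/mapP => -[a _ za]; have := nz a; rewrite za eqxx.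
Qed.

(** The default 0 in [rel_trace] never occurs: since y^(q^s) = y, raising to the power q permutes
    the summands cyclically, so the sum lies in K. *)
Lemma rel_traceE (y : L) : iota (Tr y) = \sum_(i < s) y ^+ (#|K| ^ i).
Proof.
rewrite /rel_trace; case: pickP => [a /eqP //|none].
set z := \sum_(i < s) _ in none *; suff [a za]: exists a, iota a = z.
  by have := none a; rewrite za eqxx.
apply: fixed_in_subfield; rewrite /z.
have powD (I : Type) (r : seq I) (F : I -> L) :
    (\sum_(i <- r) F i) ^+ #|K| = \sum_(i <- r) F i ^+ #|K|.
  elim/big_rec2: _ => [|i u v _ <-]; first by rewrite expr0n; case: #|K| (finNzRing_gt1 K).
  by have := expr_card_powD (F i) v 1; rewrite expn1.
rewrite powD; case: s s_gt0 cardL => // n _ cL.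
rewrite big_ord_recr [RHS]big_ord_recl /= addrC -exprM -expnSr -cL expf_card expr1.
by congr (_ + _); apply: eq_bigr => i _; rewrite -exprM -expnSr.
Qed.

Lemma rel_traceD (x y : L) : Tr (x + y) = Tr x + Tr y.
Proof.
apply: (fmorph_inj iota); rewrite rmorphD !rel_traceE -big_split /=.
by apply: eq_bigr => i _; rewrite expr_card_powD.
Qed.

Lemma rel_traceZ (a : K) (y : L) : Tr (iota a * y) = a * Tr y.
Proof.
apply: (fmorph_inj iota); rewrite rmorphM !rel_traceE mulr_sumr.
apply: eq_bigr => i _; rewrite exprMn; congr (_ * _).
elim: (nat_of_ord i) => [|j IHj]; first by rewrite expn0 expr1.
by rewrite expnSr exprM IHj -rmorphXn expf_card.
Qed.

(** Otherwise a nonzero polynomial of degree at most q^(s-1) would vanish on all q^s elements of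
    L. *)
Lemma rel_trace_neq0 : exists y, Tr y != 0.
Proof.
have q1 : (1 < #|K|)%N by apply: finNzRing_gt1.
apply/existsP; apply: contraT; rewrite negb_exists => /forallP tr0.
pose P : {poly L} := \sum_(i < s) 'X^(#|K| ^ i).
have P0 : P != 0.
  (* The coefficient of X comes from i = 0 alone and equals 1. *)
  apply/eqP => /(congr1 (fun p : {poly L} => p`_1)) /eqP.
  rewrite coef0 coef_sum; case: s s_gt0 => // n _.
  rewrite big_ord_recl coefXn expn0 eqxx big1 ?addr0 ?oner_eq0 // => i _.
  by rewrite coefXn ltn_eqF // -{1}(expn0 #|K|) ltn_exp2l.
have := @max_poly_roots _ P (enum L) P0.
rewrite enum_uniq -cardE => /(_ _ isT) H.
have : (#|L| < size P)%N.
  apply: H; apply/allP => y _; rewrite rootE horner_sum.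
  under eq_bigr do rewrite hornerXn.
  by have := tr0 y; rewrite negbK -rel_traceE fmorph_eq0.
rewrite ltnNge => /negP[]; apply: (leq_trans (size_sum _ _ _)).
apply/bigmax_leqP => i _; rewrite size_polyXn cardL ltn_exp2l //.
Qed.

End RelativeTrace.

Section AbsoluteTrace.

Variables (p m : nat) (K : finFieldType).
Hypotheses (pK : p \in [pchar K]) (m_gt0 : (0 < m)%N) (cardK : #|K| = (p ^ m)%N).

(** Serves as the embedding that makes the absolute trace an instance of the relative one. *)
Definition Fp_inj (k : 'F_p) : K := (k : nat)%:R.

Let pr_p : prime p. Proof. exact: pcharf_prime pK. Qed.

Lemma natr_mod_Fp n : (n %% (Zp_trunc (pdiv p)).+2)%:R = n%:R :> K.
Proof.
by rewrite Fp_cast // [in RHS](divn_eq n p) natrD natrM (pcharf0 pK) mulr0 add0r.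
Qed.

Lemma Fp_inj_zmod_morphism : zmod_morphism Fp_inj.
Proof.
move=> a b; apply/eqP; rewrite eq_sym subr_eq; apply/eqP.
by rewrite -{1}(subrK b a) {1}/Fp_inj natr_mod_Fp natrD.
Qed.

Lemma Fp_inj_monoid_morphism : monoid_morphism Fp_inj.
Proof. by split=> [|a b]; rewrite /Fp_inj // natr_mod_Fp natrM. Qed.

HB.instance Definition _ := GRing.isZmodMorphism.Build 'F_p K Fp_inj Fp_inj_zmod_morphism.
HB.instance Definition _ := GRing.isMonoidMorphism.Build 'F_p K Fp_inj Fp_inj_monoid_morphism.

Lemma Fp_inj_fixed (w : K) : w ^+ p = w -> exists k, Fp_inj k = w.
Proof. by move=> wp; apply: (@fixed_in_subfield _ _ Fp_inj); rewrite card_Fp. Qed.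

Lemma Fp_injM j k : Fp_inj (j * k) = Fp_inj j * Fp_inj k.
Proof. exact: rmorphM. Qed.

Lemma Fp_inj1 : Fp_inj 1 = 1.
Proof. exact: rmorph1. Qed.

Lemma Fp_inj_eq0 k : (Fp_inj k == 0) = (k == 0).
Proof. exact: fmorph_eq0. Qed.

Lemma abs_traceE x : abs_trace p m x = rel_trace Fp_inj m x.
Proof. by rewrite /abs_trace /rel_trace card_Fp. Qed.

Let cardK' : #|K| = (#|'F_p| ^ m)%N. Proof. by rewrite card_Fp. Qed.

Lemma abs_traceD x y : abs_trace p m (x + y : K) = abs_trace p m x + abs_trace p m y.
Proof. by rewrite !abs_traceE rel_traceD. Qed.

Lemma abs_trace_neq0 : exists x : K, abs_trace p m x != 0.
Proof.
by have [x] := rel_trace_neq0 Fp_inj m_gt0 cardK'; exists x; rewrite abs_traceE.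
Qed.

End AbsoluteTrace.

(** * Annihilators *)

Lemma zmod_closed_setT (Y : finZmodType) : zmod_closed [set: Y].
Proof. by split=> [|x y _ _]; apply: in_setT. Qed.

Lemma zmod_closed_set0 (Y : finZmodType) : zmod_closed [set 0 : Y].
Proof. by split=> [|x y /set1P-> /set1P->]; rewrite ?subr0 set11. Qed.

Lemma zmod_closed_add (X : zmodType) (H : {pred X}) x y :
  zmod_closed H -> x \in H -> y \in H -> x + y \in H.
Proof. by move=> [H0 HB] xH yH; rewrite -[y]opprK -(sub0r y); apply: (HB) => //; apply: HB. Qed.

Lemma zmod_closed_mulrn (X : zmodType) (H : {pred X}) n x :
  zmod_closed H -> x \in H -> x *+ n \in H.
Proof.
move=> clH xH; elim: n => [|n IHn]; first by case: clH.
by rewrite mulrS zmod_closed_add.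
Qed.

Lemma zmod_closed_addl (X : zmodType) (H : {pred X}) x y :
  zmod_closed H -> x \in H -> (x + y \in H) = (y \in H).
Proof.
move=> clH xH; apply/idP/idP => [xyH|]; last exact: zmod_closed_add.
by rewrite -(addKr x y) addrC; case: clH => _; apply.
Qed.

Section Annihilator.

Variables (p : nat) (X : finZmodType) (beta : X -> X -> 'F_p).
Hypotheses (pr_p : prime p) (betaC : forall x y, beta x y = beta y x)
  (betaDr : forall x y z, beta x (y + z) = beta x y + beta x z)
  (beta_nondeg : forall x, x != 0 -> exists y, beta x y != 0).

(** All p fibres of f on H have the size of the kernel: a suitable integer multiple of h takes the
    value k, and translation by it carries the kernel onto the fibre over k. *)
Lemma card_kernel (H : {set X}) (f : X -> 'F_p) :
  zmod_closed H -> (forall x y, f (x + y) = f x + f y) ->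
  (exists2 h, h \in H & f h != 0) -> (#|[set h in H | f h == 0%R]| * p = #|H|)%N.
Proof.
move=> clH fD [h hH fh].
have f0 : f 0 = 0 by apply: (addrI (f 0)); rewrite -fD !addr0.
have fMn x n : f (x *+ n) = f x *+ n.
  by elim: n => [|n IHn]; rewrite ?mulr0n // !mulrS fD IHn.
transitivity (\sum_(k : 'F_p) #|[set h in H | f h == 0%R]|)%N.
  by rewrite sum_nat_const card_Fp // mulnC.
rewrite -[#|H|]sum1_card (partition_big f xpredT) //=; apply: eq_bigr => k _; rewrite -sum1_card.
pose s := h *+ (k / f h : 'F_p).
have sH : s \in H by apply: zmod_closed_mulrn.
have fs : f s = k by rewrite fMn -mulr_natr natr_Zp mulrC divfK.
rewrite [RHS](reindex_inj (addrI s)) /=; apply: eq_bigl => x.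
have -> : (f (s + x) == k) = (f x == 0).
  by rewrite fD fs -[X in _ == X]addr0 (inj_eq (addrI k)).
by rewrite inE zmod_closed_addl.
Qed.

Definition annihilator (H : {set X}) := [set v | [forall h in H, beta h v == 0]].

Lemma annihilatorP (H : {set X}) v :
  reflect (forall h, h \in H -> beta h v = 0) (v \in annihilator H).
Proof. by rewrite inE; apply: 'forall_in_eqP. Qed.

Let beta0r x : beta x 0 = 0.
Proof. by apply: (addrI (beta x 0)); rewrite -betaDr !addr0. Qed.

Lemma annihilator_closed (H : {set X}) : zmod_closed (annihilator H).
Proof.
split=> [|u v /annihilatorP uH /annihilatorP vH]; apply/annihilatorP => h hH //.
have := betaDr h (u - v) v; rewrite subrK uH // vH // addr0 => <- //.
Qed.

(** Count the pairs (h, v) with h in H and beta h v = 0 twice. For fixed v the slice is H or has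
    index p in H; for fixed h it is X if h = 0 and has index p in X otherwise. *)
Lemma card_annihilator (H : {set X}) : zmod_closed H ->
  (#|annihilator H| * #|H| = #|X|)%N.
Proof.
move=> clH; have p1 := prime_gt1 pr_p.
have clT := zmod_closed_setT X.
pose zeros := [set hv : X * X | (hv.1 \in H) && (beta hv.1 hv.2 == 0)].
have zr : (#|zeros| * p = #|annihilator H| * #|H| * p.-1 + #|X| * #|H|)%N.
  have -> : #|zeros| = (\sum_v #|[set h in H | beta h v == 0%R]|)%N.
    rewrite -sum1_card (partition_big snd xpredT) //=; apply: eq_bigr => v _.
    rewrite -sum1_card (reindex_onto (pair^~ v) fst) /= => [|[a b] /andP[_ /eqP/= <-] //].
    by apply: eq_bigl => h; rewrite !inE !eqxx !andbT.
  rewrite big_distrl /= (bigID (mem (annihilator H))) /=.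
  rewrite (eq_bigr (fun=> #|H| * p)%N) => [|v /annihilatorP vH]; last first.
    congr (_ * _)%N; apply: eq_card => h; rewrite inE.
    by case: (boolP (h \in H)) => // /vH ->; rewrite eqxx.
  rewrite [X in (_ + X)%N](eq_bigr (fun=> #|H|)) => [|v]; last first.
    rewrite inE => /forall_inPn exh.
    by apply: (@card_kernel _ (beta^~ v)) => // x y; rewrite !(betaC _ v) betaDr.
  rewrite !sum_nat_const -(cardsC (annihilator H)).
  rewrite [X in (_ + X * _)%N](_ : _ = #|~: annihilator H|); last first.
    by apply: eq_card => v; rewrite inE.
  by case: p p1 => // p' _ /=; rewrite mulnS; lia.
have zl : (#|zeros| * p = #|X| * p + (#|H| - 1) * #|X|)%N.
  have -> : #|zeros| = (\sum_(h in H) #|[set v in [set: X] | beta h v == 0%R]|)%N.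
    rewrite -sum1_card (partition_big fst (mem H)) //= => [|hv]; last by rewrite inE => /andP[].
    apply: eq_bigr => h hH.
    rewrite -sum1_card (reindex_onto (pair h) snd) /= => [|[a b] /andP[_ /eqP/= <-] //].
    by apply: eq_bigl => v; rewrite !inE hH !eqxx !andbT.
  rewrite (bigD1 0) /=; last by case: clH.
  rewrite mulnDl big_distrl /=; congr (_ * _ + _)%N.
    rewrite -cardsT; apply: eq_card => v; rewrite !inE.
    by rewrite betaC beta0r.
  rewrite (eq_bigr (fun=> #|X|)) => [|h /andP[hH h0]]; last first.
    have [v bv] := beta_nondeg h0; rewrite -cardsT.
    by apply: (@card_kernel _ (beta h)) => //; exists v.
  rewrite sum_nat_const; congr (_ * _)%N; rewrite (cardD1 0 H).
  case: clH => -> _; rewrite add1n subn1 /=; apply: eq_card => v.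
  by rewrite !inE andbC.
have H0 : (0 < #|H|)%N by apply/card_gt0P; exists 0; case: clH.
have X0 : (0 < #|X|)%N by apply/card_gt0P; exists 0.
move: zr; rewrite zl.
have -> : (#|X| * p + (#|H| - 1) * #|X| = #|X| * p.-1 + #|X| * #|H|)%N by nia.
by move/addIn/eqP; rewrite eqn_pmul2r; [move/eqP | lia].
Qed.

(** One inclusion is symmetry of the pairing; equality follows by comparing cardinalities. *)
Lemma annihilatorK (H : {set X}) : zmod_closed H -> annihilator (annihilator H) = H.
Proof.
move=> clH; have clA := annihilator_closed H.
apply/esym/eqP; rewrite eqEcard; apply/andP; split.
  apply/subsetP => h hH; apply/annihilatorP => v /annihilatorP/(_ h hH).
  by rewrite betaC.
have A0 : (0 < #|annihilator H|)%N by apply/card_gt0P; exists 0; case: clA.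
by rewrite -(leq_pmul2r A0) card_annihilator // mulnC card_annihilator.
Qed.

End Annihilator.

HB.saturate prod.

(** Over the prime field scaling is repeated addition, so additive subgroups are subspaces. *)
Lemma vspace_of_zmod_closed (p : nat) (I : finType) (S : {set {ffun I -> ('F_p)^o}}) :
  zmod_closed S -> exists U : {vspace {ffun I -> ('F_p)^o}}, U =i S.
Proof.
move=> clS; exists <<enum S>>%VS => v; apply/idP/idP => [|vS]; last first.
  by apply: memv_span; rewrite mem_enum.
move/(@coord_span _ _ _ (in_tuple (enum S))) ->.
elim/big_ind: _ => [|x y xS yS|i _]; first by case: clS.
  exact: zmod_closed_add.
rewrite -[coord _ _ _]natr_Zp scaler_nat; apply: zmod_closed_mulrn => //.
by rewrite -mem_enum mem_nth.
Qed.

(** * Powers of theta and scalars of the prime field *)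

Section PrimitiveRoot.

Variables (p m N : nat) (K : finFieldType) (theta : K).
Hypotheses (pK : p \in [pchar K]) (m_gt0 : (0 < m)%N) (cardK : #|K| = (p ^ m)%N)
  (N_gt0 : (0 < N)%N) (N_dvd : (N %| p.-1)%N)
  (coN : coprime N ((p ^ m).-1 %/ p.-1))
  (prim_theta : ((p ^ m).-1 %/ N).-primitive_root theta).

Let pr_p : prime p. Proof. exact: pcharf_prime pK. Qed.

Let p_gt1 : (1 < p)%N. Proof. exact: prime_gt1. Qed.

Let expf_card1 (z : K) : z != 0 -> z ^+ (p ^ m).-1 = 1.
Proof.
move=> z0; apply/(mulfI z0); rewrite -exprS mulr1 prednK -?cardK ?expf_card //.
exact: ltnW (finNzRing_gt1 K).
Qed.

Lemma dvdn_pred_exp : (p.-1 %| (p ^ m).-1)%N.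
Proof. by rewrite predn_exp dvdn_mulr. Qed.

(** With D = (q-1)/(p-1), Bezout gives aN = bD + 1, so z = z^(-bD) z^(aN). The first factor is fixed
    by the p-th power map and lies in the prime field; the second is a root of unity of order
    dividing (q-1)/N. *)
Lemma Fp_root_cover (z : K) : z != 0 ->
  exists k : 'F_p, exists2 t : K, t ^+ ((p ^ m).-1 %/ N) = 1 & k != 0 /\ z = Fp_inj K k * t.
Proof.
move=> z0; pose D := ((p ^ m).-1 %/ p.-1)%N.
case: (egcdnP D N_gt0) => a b; rewrite (eqP coN : gcdn N D = 1%N) => bez _.
have zn (c : nat) : z ^+ c != 0 by rewrite expf_neq0.
have [k wk] : exists k : 'F_p, Fp_inj K k = (z ^+ b) ^- D.
  have yp : ((z ^+ b) ^+ D) ^+ p.-1 = 1.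
    by rewrite -!exprM divnK ?dvdn_pred_exp // mulnC exprM expf_card1 // expr1n.
  by apply: (Fp_inj_fixed pK); rewrite -[p in _ ^+ p](prednK (ltnW p_gt1)) exprS exprVn yp invr1 mulr1.
exists k; exists ((z ^+ a) ^+ N).
  by rewrite -!exprM mulnC exprM [(N * _)%N]mulnC divnK ?expf_card1 ?expr1n //
     (dvdn_trans N_dvd) // dvdn_pred_exp.
split; last by rewrite wk -!exprM bez exprD expr1 mulKf.
by rewrite -(Fp_inj_eq0 pK) wk invr_eq0 -exprM zn.
Qed.

Local Notation n := ((p ^ m).-1 %/ N)%N.

Let card_n : (n * N = #|K|.-1)%N.
Proof. by rewrite cardK divnK // (dvdn_trans N_dvd) // dvdn_pred_exp. Qed.

Let n_gt0 : (0 < n)%N.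
Proof.
have q1 : (1 < #|K|)%N by apply: finNzRing_gt1.
by rewrite lt0n; apply/eqP => n0; have := card_n; rewrite n0 mul0n; lia.
Qed.

Lemma sum_root_powers (g : K -> nat) :
  (\sum_(i < n) g (theta ^+ i) = \sum_(t : K | t ^+ n == 1%R) g t)%N.
Proof.
(* The implication makes the choice of an exponent total on K; outside the roots of unity the index
   is arbitrary. *)
have prT (t : K) : exists i : 'I_n, (t ^+ n == 1) ==> (t == theta ^+ i).
  have [/eqP tn|_] := boolP (t ^+ n == 1); last by exists (Ordinal n_gt0).
  by have [i ->] := prim_rootP prim_theta tn; exists i; rewrite eqxx.
pose idx_of t := xchoose (prT t).
have idxP (t : K) : t ^+ n == 1 -> theta ^+ idx_of t = t.
  by move=> tn; have /implyP/(_ tn)/eqP <- := xchooseP (prT t).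
rewrite [RHS](reindex_onto (fun i : 'I_n => theta ^+ i) idx_of) => [|t /idxP//].
apply: eq_bigl => i /=.
have ti : (theta ^+ i) ^+ n == 1 by rewrite exprAC (prim_expr_order prim_theta) expr1n.
rewrite ti /=; apply/esym/eqP/val_inj/eqP.
have /eqP := idxP _ ti; rewrite (eq_prim_root_expr prim_theta) !modn_small //.
Qed.

(* Averaging over z0 = k t0: since g absorbs k and t0 permutes the roots,
   sum_t g (z0 t) = sum_t g t for every z0 != 0. *)
Lemma sum_over_units (g : K -> nat) :
  (forall (k : 'F_p) z, k != 0 -> g (Fp_inj K k * z) = g z) ->
  (N * \sum_(i < n) g (theta ^+ i) = \sum_(z | z != 0%R) g z)%N.
Proof.
move=> gk; rewrite sum_root_powers.
have shift (z : K) : z != 0 ->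
    (\sum_(t : K | t ^+ n == 1%R) g (z * t)%R = \sum_(t : K | t ^+ n == 1%R) g t)%N.
  move=> z0; have [k [t0 t0n [k0 zE]]] := Fp_root_cover z0.
  have t00 : t0 != 0 by apply: contraNneq z0 => t00; rewrite zE t00 mulr0.
  rewrite [RHS](reindex_inj (mulfI t00)) /=; apply: eq_big => t; rewrite ?exprMn ?t0n ?mul1r //.
  by move=> _; rewrite zE -mulrA gk.
have card_roots : #|[pred t : K | t ^+ n == 1]| = n.
  transitivity (\sum_(t : K | t ^+ n == 1%R) 1)%N; first by rewrite sum1_card.
  by rewrite -(sum_root_powers (fun=> 1%N)) sum1_card card_ord.
(* Each root t permutes the nonzero z, which gives this value. Summing over t first instead gives q
   - 1 = nN equal sums by [shift], and n cancels. *)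
have dbl : (\sum_(z : K | z != 0%R) \sum_(t : K | t ^+ n == 1%R) g (z * t)%R
            = n * \sum_(z : K | z != 0%R) g z)%N.
  rewrite exchange_big /= -{2}card_roots -sum_nat_const; apply: eq_bigr => t /eqP tn.
  have t0 : t != 0.
    by apply/eqP => t0; move/eqP: tn; rewrite t0 expr0n gtn_eqF // eq_sym oner_eq0.
  rewrite [RHS](reindex_inj (mulIf t0)) /=; apply: eq_bigl => z.
  by rewrite mulf_eq0 (negPf t0) orbF.
move: dbl; rewrite (eq_bigr _ shift) sum_nat_const.
have -> : #|[pred z : K | z != 0]| = (n * N)%N.
  by rewrite card_n -(cardC1 (0 : K)); apply: eq_card.
by rewrite -mulnA => /eqP; rewrite eqn_pmul2l // => /eqP.
Qed.

End PrimitiveRoot.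

(** * Subcodes of the descended code *)

Section DescendedCode.

Variables (p m m2 N : nat) (K L1 L2 : finFieldType).
Variables (iota : {rmorphism K -> L2}) (Q : L1 -> K) (theta : K).
Hypotheses (pK : p \in [pchar K]) (m_gt0 : (0 < m)%N) (m2_gt0 : (0 < m2)%N)
  (cardK : #|K| = (p ^ m)%N) (cardL2 : #|L2| = (#|K| ^ m2)%N)
  (N_gt0 : (0 < N)%N) (N_dvd : (N %| p.-1)%N)
  (coN : coprime N ((p ^ m).-1 %/ p.-1))
  (prim_theta : ((p ^ m).-1 %/ N).-primitive_root theta)
  (Q0 : Q 0 = 0) (Qnz : exists x, Q x != 0).

Local Notation n := ((p ^ m).-1 %/ N)%N.
Local Notation tr := (abs_trace p m).
Local Notation Tr := (rel_trace iota m2).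
Local Notation X := (K * L2 * K)%type.
Local Notation word := {ffun idx L1 L2 n -> ('F_p)^o}.
Local Notation C := (@desc_code p m m2 n K L1 L2 iota Q theta).

Let pr_p : prime p. Proof. exact: pcharf_prime pK. Qed.

Definition trace_pairing (h v : X) : 'F_p :=
  tr (h.1.1 * v.1.1 + Tr (h.1.2 * v.1.2) + h.2 * v.2).

Lemma trace_pairingC h v : trace_pairing h v = trace_pairing v h.
Proof. by rewrite /trace_pairing mulrC [h.1.2 * _]mulrC [h.2 * _]mulrC. Qed.

Lemma trace_pairingDr h u v :
  trace_pairing h (u + v) = trace_pairing h u + trace_pairing h v.
Proof.
rewrite /trace_pairing -(abs_traceD pK m_gt0 cardK) /= !mulrDr (rel_traceD iota m2_gt0 cardL2).
by congr (tr _); ring.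
Qed.

Lemma trace_pairing_nondeg h : h != 0 -> exists v, trace_pairing h v != 0.
Proof.
case: h => [[a b] c] h0; have [x tx] := abs_trace_neq0 pK m_gt0 cardK.
have Tr0 : Tr 0 = 0.
  by apply: (addrI (Tr 0)); rewrite -(rel_traceD iota m2_gt0 cardL2) !addr0.
have [a0|a0] := eqVneq a 0; last first.
  exists (a^-1 * x, 0, 0); rewrite /trace_pairing /= !mulr0 Tr0 !addr0.
  by rewrite mulVKf.
have [b0|b0] := eqVneq b 0; last first.
  have [y ty] := rel_trace_neq0 iota m2_gt0 cardL2.
  (* The factor x / Tr y is chosen so that the relative trace of the product with b is x. *)
  exists (0, b^-1 * (iota (x / Tr y) * y), 0); rewrite /trace_pairing /= !mulr0.
  by rewrite mulVKf // (rel_traceZ iota m2_gt0 cardL2) divfK // addr0 add0r.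
have c0 : c != 0.
  by apply: contraNneq h0 => c0; rewrite a0 b0 c0.
exists (0, 0, c^-1 * x); rewrite /trace_pairing /= !mulr0 Tr0 !add0r.
by rewrite mulVKf.
Qed.

Definition encode (h : X) : word :=
  [ffun j : idx L1 L2 n => tr ((h.1.1 * Q j.1.1 + Tr (h.1.2 * j.1.2) + h.2) * theta ^+ j.2)].

(* Letting the coordinate ((x, y), i) act on (a, b, c) through a single vector
   of K x L2 x K turns supports of subcodes into complements of annihilators. *)
Definition coord_vector (j : idx L1 L2 n) : X :=
  (theta ^+ j.2 * Q j.1.1, iota (theta ^+ j.2) * j.1.2, theta ^+ j.2).

Lemma encodeE h j : encode h j = trace_pairing h (coord_vector j).
Proof.
rewrite ffunE /trace_pairing /=; congr (tr _).
rewrite [h.1.2 * (_ * _)]mulrCA (rel_traceZ iota m2_gt0 cardL2).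
by ring.
Qed.

Lemma desc_codeE v : C v <-> exists h, v = encode h.
Proof.
split=> [[a [b [c vE]]]|[[[a b] c] ->]]; last first.
  by exists a, b, c => x y i; rewrite ffunE.
by exists (a, b, c); apply/ffunP => -[[x y] i]; rewrite ffunE vE.
Qed.

Lemma encodeD g h : encode (g + h) = encode g + encode h.
Proof.
apply/ffunP => j; rewrite [RHS]ffunE !encodeE -!(trace_pairingC (coord_vector j)).
exact: trace_pairingDr.
Qed.

Lemma encode0 : encode 0 = 0.
Proof. by apply: (addrI (encode 0)); rewrite -encodeD !addr0. Qed.

Lemma encodeB g h : encode (g - h) = encode g - encode h.
Proof. by apply/eqP; rewrite eq_sym subr_eq -encodeD subrK. Qed.

(** Scaling by an element of the prime field is repeated addition, under which additive subgroups
    are stable. *)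
Lemma annihilator_code_closed (V : {set X}) (k : 'F_p) v : zmod_closed V ->
  v \in V -> (Fp_inj K k * v.1.1, iota (Fp_inj K k) * v.1.2, Fp_inj K k * v.2) \in V.
Proof.
move=> clV vV; suff <- : v *+ k = (Fp_inj K k * v.1.1, iota (Fp_inj K k) * v.1.2, Fp_inj K k * v.2).
  exact: zmod_closed_mulrn.
case: v {vV} => [[u w] z]; rewrite /Fp_inj rmorph_nat !mulr_natl /=.
by elim: (nat_of_ord k) => [|j IHj] //; rewrite !mulrS IHj.
Qed.

(** Counts zero coordinates with theta^i replaced by an arbitrary z, so that the sum over powers of
    theta can be spread over all nonzero z. *)
Definition zeros_over (V : {set X}) (z : K) : nat :=
  #|[set xy : L1 * L2 | (z * Q xy.1, iota z * xy.2, z) \in V]|.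

Lemma zeros_over_scale (V : {set X}) (k : 'F_p) z : zmod_closed V -> k != 0 ->
  zeros_over V (Fp_inj K k * z) = zeros_over V z.
Proof.
move=> clV k0; apply: eq_card => -[x y]; rewrite !inE /=.
have kK : Fp_inj K k != 0 by rewrite (Fp_inj_eq0 pK).
have kV : Fp_inj K k^-1 = (Fp_inj K k)^-1.
  by apply: (mulIf kK); rewrite mulVf // -(Fp_injM pK) mulVf // (Fp_inj1 pK).
apply/idP/idP => [/(annihilator_code_closed k^-1 clV)|/(annihilator_code_closed k clV)] /=.
  by rewrite kV !mulrA -rmorphM !mulrA mulVf // !mul1r.
by rewrite !mulrA -rmorphM.
Qed.

Definition fiber (t : K) : nat := #|[set x : L1 | Q x == t]|.

Definition weight (V : {set X}) : nat :=
  (\sum_(v in V | v.2 != 0%R) fiber (v.1.1 / v.2)%R)%N.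

(** A point (x, y) hits (u, w, z) in V, with z != 0, exactly when Q(x) = u/z and y = w/z: y is
    forced and x runs over one fibre of Q. *)
Lemma sum_zeros_over (V : {set X}) :
  (\sum_(z | z != 0%R) zeros_over V z = weight V)%N.
Proof.
rewrite /weight (partition_big snd (fun z => z != 0)) /= => [|v /andP[]//].
apply: eq_bigr => z z0; rewrite /zeros_over.
have iz0 : iota z != 0 by rewrite fmorph_eq0.
transitivity (\sum_(v in V | v.2 == z) fiber (v.1.1 / z))%N; last first.
  apply: eq_big => [v|v /andP[_ /eqP->] //].
  by case: eqP => [->|]; rewrite ?andbF // z0 !andbT.
rewrite -sum1_card.
rewrite (partition_big (fun xy : L1 * L2 => (z * Q xy.1, iota z * xy.2, z))
  (fun v => (v \in V) && (v.2 == z))) /= => [|xy]; last by rewrite inE eqxx andbT.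
apply: eq_bigr => -[[u w] z'] /= /andP[vV /eqP zz']; subst z'.
rewrite /fiber -sum1_card.
rewrite (reindex_onto (fun x : L1 => (x, (iota z)^-1 * w)) fst) /=; last first.
  move=> [x y] /andP[_ /eqP[_ <-]]; by rewrite mulKf.
apply: eq_bigl => x; rewrite !inE eqxx andbT /= mulVKf // !xpair_eqE !eqxx !andbT.
apply/andP/eqP => [[_ /eqP <-]|->]; first by rewrite mulrC mulKf.
by rewrite mulrC divfK // eqxx.
Qed.

Lemma card_zero_coords (V : {set X}) : zmod_closed V ->
  (N * #|[set j | coord_vector j \in V]| = weight V)%N.
Proof.
move=> clV; rewrite -sum_zeros_over.
rewrite -(sum_over_units pK m_gt0 cardK N_gt0 N_dvd coN prim_theta); last first.
  by move=> k z; apply: zeros_over_scale.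
congr (_ * _)%N; rewrite -sum1_card (partition_big snd xpredT) //=.
apply: eq_bigr => i _; rewrite /zeros_over -sum1_card.
rewrite (reindex_onto (fun xy => (xy, i)) fst) /=; last by move=> [xy i'] /andP[_ /eqP/= <-].
by apply: eq_bigl => xy; rewrite !inE !eqxx !andbT.
Qed.

(** If h encodes to 0, its annihilator contains every coordinate vector, hence by [Fp_root_cover]
    every (zQ(x), w, z) with z != 0. Differences of these generate K x L2 x K, because Q takes a
    nonzero value, and nondegeneracy forces h = 0. *)
Lemma encode_inj : injective encode.
Proof.
move=> g h /eqP; rewrite -subr_eq0 -encodeB => /eqP eh; apply/eqP; rewrite -subr_eq0.
move: (g - h) eh => {g}h eh; pose V := annihilator trace_pairing [set h].
have clV : zmod_closed V by apply: annihilator_closed trace_pairingDr _.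
have coordV j : coord_vector j \in V.
  by apply/annihilatorP => _ /set1P->; rewrite -encodeE eh ffunE.
have V1 x w z : z != 0 -> (z * Q x, w, z) \in V.
  move=> z0.
  have [k [t tn [_ zE]]] := Fp_root_cover pK cardK N_gt0 N_dvd coN z0.
  have [i tE] := prim_rootP prim_theta tn.
  have := annihilator_code_closed k clV (coordV ((x, (iota z)^-1 * w), i)).
  rewrite /= -tE !mulrA -rmorphM -zE mulfV ?mul1r //.
  by rewrite fmorph_eq0.
have V2 w : (0, w, 0) \in V.
  have [_ VB] := clV; rewrite (_ : (0, w, 0) = (1 * Q 0, w, 1) - (1 * Q 0, 0, 1)) ?VB ?V1 ?oner_neq0 //.
  by congr (_, _, _); rewrite /= ?subrr ?subr0.
have V3 z : (0, 0, z) \in V.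
  have [->|/(V1 0 0)] := eqVneq z 0; first exact: V2.
  by rewrite Q0 mulr0.
have V4 u : (u, 0, 0) \in V.
  have [->|u0] := eqVneq u 0; first exact: V2.
  have [x Qx] := Qnz; have ux0 : u / Q x != 0 by rewrite mulf_neq0 ?invr_eq0.
  have [_ VB] := clV.
  rewrite (_ : (u, 0, 0) = (u / Q x * Q x, 0, u / Q x) - (0, 0, u / Q x)) ?VB ?V1 //.
  by congr (_, _, _); rewrite /= ?subrr ?subr0 ?divfK.
have [//|/trace_pairing_nondeg[[[u w] z]]] := eqVneq h 0.
have : (u, w, z) \in V.
  rewrite (_ : (u, w, z) = (u, 0, 0) + (0, w, 0) + (0, 0, z)).
    by apply: zmod_closed_add => //; apply: zmod_closed_add.
  by congr (_, _, _); rewrite /= ?addr0 ?add0r.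
by move/annihilatorP/(_ h (set11 h)) => ->; rewrite eqxx.
Qed.

Lemma supp_annihilator (U : {vspace word}) (H : {set X}) :
  (forall h, (h \in H) = (encode h \in U)) -> (forall v, v \in U -> C v) ->
  ~: supp U = [set j | coord_vector j \in annihilator trace_pairing H].
Proof.
move=> HU UC; apply/setP => j; rewrite !inE negb_exists; apply/forallP/forall_inP.
  move=> Uj h; rewrite HU => hU; have := Uj (encode h).
  by rewrite hU /= negbK encodeE.
move=> Hj v; rewrite negb_and negbK -implybE; apply/implyP => vU.
have /desc_codeE[h vh] := UC v vU; rewrite vh encodeE Hj // HU -vh //.
Qed.

Lemma card_supp (U : {vspace word}) (V : {set X}) : zmod_closed V ->
  ~: supp U = [set j | coord_vector j \in V] ->
  (N * #|supp U| + weight V = #|L1| * #|L2| * (p ^ m).-1)%N.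
Proof.
move=> clV sV; rewrite -card_zero_coords // -sV -mulnDr cardsC.
rewrite !card_prod card_ord mulnCA [(N * n)%N]mulnC divnK //.
by rewrite (dvdn_trans N_dvd) // dvdn_pred_exp.
Qed.

Lemma annihilator_of_subcode (U : {vspace word}) : (forall v, v \in U -> C v) ->
  exists2 V : {set X}, zmod_closed V /\ (#|V| * p ^ \dim U = #|{: X}|)%N &
    (N * #|supp U| + weight V = #|L1| * #|L2| * (p ^ m).-1)%N.
Proof.
move=> UC; pose H := [set h | encode h \in U].
have clH : zmod_closed H.
  by split=> [|g h]; rewrite !inE ?encode0 ?mem0v // encodeB => gU hU; rewrite memvB.
have HU h : (h \in H) = (encode h \in U) by rewrite inE.
have cardH : #|H| = (p ^ \dim U)%N.
  rewrite -[p in (p ^ _)%N](card_Fp pr_p) -card_vspace -(card_imset _ encode_inj).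
  apply: eq_card => v; apply/imsetP/idP => [[h]|vU]; first by rewrite HU => hU ->.
  by have /desc_codeE[h vh] := UC v vU; exists h; rewrite ?HU -?vh.
exists (annihilator trace_pairing H).
  split; first by apply: annihilator_closed trace_pairingDr _.
  by rewrite -cardH (card_annihilator pr_p trace_pairingC trace_pairingDr trace_pairing_nondeg).
by apply: card_supp (supp_annihilator HU UC); apply: annihilator_closed trace_pairingDr _.
Qed.

(** The subcode encodes the annihilator of V; biduality recovers V from it. *)
Lemma subcode_of_annihilator (V : {set X}) r : zmod_closed V ->
  (#|V| * p ^ r = #|{: X}|)%N ->
  exists U : {vspace word}, [/\ \dim U = r, forall v, v \in U -> C v &
    (N * #|supp U| + weight V = #|L1| * #|L2| * (p ^ m).-1)%N].
Proof.
move=> clV cV; pose H := annihilator trace_pairing V.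
have clH : zmod_closed H by apply: annihilator_closed trace_pairingDr _.
have [U UE] : exists U : {vspace word}, U =i encode @: H.
  apply: vspace_of_zmod_closed; case: clH => H0 HB; split; first by rewrite -encode0 imset_f.
  by move=> _ _ /imsetP[g gH ->] /imsetP[h hH ->]; rewrite -encodeB imset_f // HB.
have HU h : (h \in H) = (encode h \in U).
  by rewrite UE mem_imset //; apply: encode_inj.
have UC v : v \in U -> C v.
  by rewrite UE => /imsetP[h _ ->]; apply/desc_codeE; exists h.
have V0 : (0 < #|V|)%N by apply/card_gt0P; exists 0; case: clV.
exists U; split => //.
  apply/eqP; rewrite -(eqn_exp2l _ _ (prime_gt1 pr_p)).
  have <- : #|U| = (p ^ \dim U)%N by rewrite card_vspace card_Fp.
  rewrite (eq_card UE) (card_imset _ encode_inj) -(eqn_pmul2l V0) cV.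
  by rewrite mulnC (card_annihilator pr_p trace_pairingC trace_pairingDr trace_pairing_nondeg).
apply: card_supp => //; rewrite (supp_annihilator HU UC).
by rewrite (annihilatorK pr_p trace_pairingC trace_pairingDr trace_pairing_nondeg).
Qed.

(** N times the support size plus the weight is constant, so the smallest support belongs to the
    largest weight. *)
Lemma ghw_of_max_weight (V : {set X}) r x : zmod_closed V ->
  (#|V| * p ^ r = #|{: X}|)%N ->
  (forall V' : {set X}, zmod_closed V' -> (#|V'| * p ^ r = #|{: X}|)%N ->
    (weight V' <= weight V)%N) ->
  x * N%:R = (#|L1| * #|L2| * (p ^ m).-1)%:R - (weight V)%:R ->
  ghw_eq C r x.
Proof.
move=> clV cV maxV xE; have [U [dU UC sU]] := subcode_of_annihilator clV cV.
exists #|supp U|; split; last first.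
  have N0 : N%:R != 0 :> rat by rewrite pnatr_eq0 -lt0n.
  by apply: (mulIf N0); rewrite xE -sU natrD addrK natrM mulrC.
split; first by exists U.
move=> U' dU' UC'; have [V' [clV' cV'] sU'] := annihilator_of_subcode UC'.
rewrite dU' in cV'; rewrite -(leq_pmul2l N_gt0) -(leq_add2r (weight V)) sU -sU'.
by rewrite leq_add2l maxV.
Qed.

End DescendedCode.

(** * Weights of subgroups *)

Lemma exists_zmod_closed (X : finZmodType) p k j : prime p -> #|X| = (p ^ k)%N -> (j <= k)%N ->
  exists2 W : {set X}, zmod_closed W & #|W| = (p ^ j)%N.
Proof.
move=> pr_p cX jk.
have pX : (p.-group [set: X])%g by rewrite /pgroup cardsT cX pnatX pnat_id.
have := @normal_pgroup p X j [set: X]%G [set: X]%G pX (normal_refl _).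
rewrite cardsT cX pfactorK // => /(_ jk)[W [_ _ cW]].
exists W => //; split=> [|x y xW yW]; first exact: (group1 W).
exact: (groupM xW (groupVr yW)).
Qed.

(** Each fibre of phi on H is empty or a translate of the zero slice. *)
Lemma card_slice (K : finZmodType) (X : finZmodType) (H : {set X}) (phi : X -> K) : zmod_closed H ->
  (forall u v, phi (u - v) = phi u - phi v) ->
  #|H|%:R <= #|K|%:R * #|[set v in H | phi v == 0]|%:R :> rat.
Proof.
move=> clH phiB; rewrite -natrM ler_nat -[#|H|]sum1_card (partition_big phi xpredT) //=.
rewrite -sum_nat_const; apply: leq_sum => k _.
case: (pickP [pred v in H | phi v == k]) => [v0 /andP[v0H /eqP v0k]|none]; last first.
  by rewrite big_pred0.
rewrite sum1dep_card -(card_imset _ (subIr v0)); apply/subset_leq_card/subsetP => _ /imsetP[v vHk ->].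
move: vHk; rewrite inE => /andP[vH /eqP vk]; rewrite inE phiB vk v0k subrr eqxx.
by case: clH => _ HB; rewrite HB.
Qed.

Lemma zmod_closed_slice (K X : finZmodType) (H : {set X}) (phi : X -> K) : zmod_closed H ->
  (forall u v, phi (u - v) = phi u - phi v) -> zmod_closed [set v in H | phi v == 0].
Proof.
case=> H0 HB phiB; split=> [|u v]; rewrite !inE.
  by rewrite H0 -(subrr 0) phiB subrr eqxx.
by move=> /andP[uH /eqP u0] /andP[vH /eqP v0]; rewrite HB // phiB u0 v0 subrr eqxx.
Qed.

Lemma cauchy_schwarz_sum (I : finType) (P : pred I) (F : I -> rat) :
  (\sum_(i | P i) F i) ^+ 2 <= (\sum_(i | P i) 1) * \sum_(i | P i) F i ^+ 2.
Proof.
set T := \sum_(i | P i) F i; set k := \sum_(i | P i) 1; set T2 := \sum_(i | P i) _.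
have k0 : 0 <= k by apply: sumr_ge0.
have : 0 <= k * (k * T2 - T ^+ 2).
  rewrite [leRHS](_ : _ = \sum_(i | P i) (k * F i - T) ^+ 2); last first.
    rewrite (eq_bigr (fun i => k ^+ 2 * F i ^+ 2 - 2 * k * T * F i + T ^+ 2 * 1)); last by move=> i _; ring.
    by rewrite big_split sumrB /= -!mulr_sumr -/T -/k -/T2; ring.
  by apply: sumr_ge0 => i _; apply: sqr_ge0.
have [k_eq0 _|k_neq0] := eqVneq k 0.
  rewrite /T big1 ?expr0n /= ?mulr_ge0 //; first by apply: sumr_ge0 => i _; apply: sqr_ge0.
  move=> i Pi; have : 1 <= k by rewrite /k (bigD1 i) //= lerDl sumr_ge0.
  by rewrite k_eq0.
by rewrite pmulr_rge0 ?subr_ge0 // lt0r k_neq0.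
Qed.

(** Here v = |V|, P is the index of V, l = |L|, s is the sum over V, and u, z, uz count the slices.
    The slice bounds turn Cauchy-Schwarz into P s^2 <= (P-1) l (q^2 l - v), whose right side, as vP
    = q^2 l, is P times the square of the claimed bound. *)
Lemma coset_sum_bound (v P q l s u z uz : rat) :
  0 < v -> 1 < P -> 0 < q -> 0 < l -> v * P = q * l * q ->
  v <= q * z -> v <= q * u -> uz <= l ->
  (- (v * s)) ^+ 2 <=
    v * (P - 1) * (v * (l * (q ^+ 2 * uz - q * u - q * z + v)) - v * s ^+ 2) ->
  s <= l * q * (1 - P^-1).
Proof.
move=> v0 P1 q0 l0 vP vz vu uzl CS; have P0 : 0 < P by lra.
have R_le : q ^+ 2 * uz - q * u - q * z + v <= q ^+ 2 * l - v.
  have : q ^+ 2 * uz <= q ^+ 2 * l by rewrite ler_pM2l // exprn_gt0.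
  lra.
have {}CS : v * s ^+ 2 <= (P - 1) * (v * (l * (q ^+ 2 * l - v)) - v * s ^+ 2).
  rewrite -(ler_pM2l v0) (_ : v * (v * s ^+ 2) = (- (v * s)) ^+ 2); last by ring.
  apply: le_trans CS _; rewrite -mulrA !ler_pM2l ?subr_gt0 // lerD2r.
  by rewrite !ler_pM2l.
have {CS R_le vz vu uzl} Ps : P * s ^+ 2 <= (P - 1) * (l * (q ^+ 2 * l - v)).
  by rewrite -(ler_pM2l v0); lra.
have vE : v = q ^+ 2 * l / P by rewrite -(mulfK (lt0r_neq0 P0) v) vP; congr (_ / _); ring.
have B0 : 0 <= l * q * (1 - P^-1).
  apply: mulr_ge0; first by apply: mulr_ge0; apply: ltW.
  by rewrite subr_ge0 invf_le1 // ltW.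
rewrite leNgt; apply/negP => hs.
have : (l * q * (1 - P^-1)) ^+ 2 < s ^+ 2 by rewrite ltr_pXn2r ?nnegrE //; lra.
apply/negP; rewrite -leNgt -(ler_pM2l P0); apply: le_trans Ps _.
rewrite vE le_eqVlt; apply/orP; left; apply/eqP; field; exact: lt0r_neq0.
Qed.

Section WeightBounds.

Variables (K L : finFieldType).

Local Notation X := (K * L * K)%type.
Local Notation q := (#|K|%:R : rat).
Local Notation qL := (#|L|%:R : rat).

Definition wt (f : K -> rat) (V : {set X}) : rat :=
  \sum_(v in V | v.2 != 0) f (v.1.1 / v.2).

Let q_gt0 : 0 < q.
Proof. by rewrite ltr0n; apply/card_gt0P; exists 0. Qed.

Let qL_gt0 : 0 < qL.
Proof. by rewrite ltr0n; apply/card_gt0P; exists 0. Qed.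

Lemma sum_triple (F : X -> rat) :
  \sum_v F v = \sum_u \sum_w \sum_z F (u, w, z).
Proof.
rewrite (pair_bigA _ (fun u w => \sum_z F (u, w, z))) /=.
by rewrite (pair_bigA _ (fun uw z => F (uw.1, uw.2, z))) /=; apply: eq_bigr => -[[u w] z].
Qed.

Lemma card_triple : #|{: X}|%:R = q * qL * q :> rat.
Proof. by rewrite !card_prod !natrM. Qed.

(** * Slice counts of a subgroup and character sums over its cosets *)

Section SubgroupCounts.

Variable V : {set X}.
Hypothesis clV : zmod_closed V.

Definition num_u0 : rat := #|[set v in V | v.1.1 == 0]|%:R.
Definition num_z0 : rat := #|[set v in V | v.2 == 0]|%:R.
Definition num_uz0 : rat := #|[set v in V | (v.1.1 == 0) && (v.2 == 0)]|%:R.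

Lemma num_z0_ge : #|V|%:R <= q * num_z0.
Proof. exact: card_slice. Qed.

Lemma num_u0_ge : #|V|%:R <= q * num_u0.
Proof. exact: (card_slice (phi := fun v => v.1.1)). Qed.

Lemma num_z0_ge1 : 1 <= num_z0.
Proof.
by rewrite ler1n; apply/card_gt0P; exists 0; rewrite inE eqxx andbT; case: clV.
Qed.

Lemma num_uz0_ge : num_u0 <= q * num_uz0.
Proof.
have -> : num_uz0 = #|[set v in [set v in V | v.1.1 == 0] | v.2 == 0]|%:R.
  by congr (_ %:R); apply: eq_card => v; rewrite !inE andbA.
by apply: card_slice => //; apply: (zmod_closed_slice (phi := fun v : X => v.1.1)).
Qed.

Lemma num_u0_le : num_u0 <= qL * q.
Proof.
rewrite /num_u0 -natrM -card_prod ler_nat -(card_imset _ (f := fun wz : L * K => (0 : K, wz.1, wz.2))).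
  apply/subset_leq_card/subsetP => -[[u w] z]; rewrite inE => /andP[_ /eqP/= ->].
  by apply/imsetP; exists (w, z).
by move=> [w z] [w' z'] [-> ->].
Qed.

Lemma num_uz0_le : num_uz0 <= qL.
Proof.
rewrite /num_uz0 ler_nat -(card_imset _ (f := fun w : L => (0 : K, w, 0 : K))).
  apply/subset_leq_card/subsetP => -[[u w] z]; rewrite inE => /and3P[_ /eqP/= -> /eqP ->].
  by apply/imsetP; exists w.
by move=> w w' [->].
Qed.

Lemma sum_indicator (P : pred X) :
  \sum_(v in V) (P v)%:R = #|[set v in V | P v]|%:R :> rat.
Proof.
rewrite (bigID P) /= [X in _ + X]big1 ?addr0 => [|v /andP[_ /negPf->]//].
rewrite (eq_bigr (fun=> 1)) => [|v /andP[_ ->] //].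
by rewrite -sum1dep_card natr_sum.
Qed.

Lemma num_z_neq0 : \sum_(v in V | v.2 != 0) 1 = #|V|%:R - num_z0 :> rat.
Proof.
rewrite /num_z0 -sum1dep_card -sum1_card !natr_sum.
by rewrite [X in _ = X - _](bigID (fun v : X => v.2 == 0)) /= addrAC subrr add0r.
Qed.

Lemma wt_le f b : (forall t, f t <= b) -> wt f V <= b * (#|V|%:R - num_z0).
Proof.
move=> fb; rewrite -num_z_neq0 mulr_sumr; apply: ler_sum => v _.
by rewrite mulr1.
Qed.

(** For z != 0, u/z vanishes exactly when u does, so this weight sees V only through its slice
    counts. *)
Lemma wt_nu A B : wt (fun t => A + B * nu t) V =
  (A - B) * (#|V|%:R - num_z0) + B * q * (num_u0 - num_uz0).
Proof.
have -> : num_u0 - num_uz0 = \sum_(v in V | v.2 != 0) (v.1.1 == 0)%:R.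
  rewrite /num_u0 -sum_indicator (bigID (fun v : X => v.2 == 0)) /= addrC.
  rewrite (_ : num_uz0 = \sum_(v in V | v.2 == 0) (v.1.1 == 0)%:R) ?addrK //.
  rewrite /num_uz0 -sum_indicator [LHS](bigID (fun v : X => v.2 == 0)) /=.
  rewrite [X in _ + X]big1 ?addr0 => [|v /andP[_ /negPf->]]; last by rewrite andbF.
  by apply: eq_bigr => v /andP[_ ->]; rewrite andbT.
rewrite -num_z_neq0 !mulr_sumr -big_split; apply: eq_bigr => v /andP[_ z0] /=.
by rewrite nuE mulf_eq0 invr_eq0 (negPf z0) orbF; ring.
Qed.

Hypothesis oddK : odd #|K|.

Definition eta_prod (v : X) : rat := eta v.1.1 * eta v.2.

(** The sum factors into autocorrelations in the two outer coordinates; the free middle one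
    contributes |L|. *)
Lemma eta_prod_autocorrelation d :
  \sum_c eta_prod c * eta_prod (c + d) = qL * (nu d.1.1 * nu d.2).
Proof.
case: d => [[a b] c]; rewrite sum_triple /eta_prod /= -!(autocorrelation_eta oddK).
rewrite big_distrlr mulr_sumr; apply: eq_bigr => u _ /=.
rewrite sumr_const -[LHS]mulr_natl; congr (_ * _).
by apply: eq_bigr => z _; ring.
Qed.

(* The sums S over the cosets of V add up to 0, and the sum of their squares is an
   autocorrelation sum over V; Cauchy-Schwarz on the nontrivial cosets then bounds S 0. *)
Lemma eta_prod_sum_le (P : nat) : (1 < P)%N -> (#|V| * P = #|{: X}|)%N ->
  \sum_(v in V) eta_prod v <= qL * q * (1 - P%:R^-1).
Proof.
move=> P1 cV; pose S c := \sum_(v in V) eta_prod (c + v).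
have SV c : c \in V -> S c = S 0.
  move=> cV'; rewrite /S [RHS](reindex_inj (addrI c)) /=.
  by apply: eq_big => [v|v _]; rewrite ?add0r // zmod_closed_addl.
have sumS : \sum_c S c = 0.
  rewrite exchange_big big1 // => v _; rewrite (reindex_inj (addIr (- v))) /=.
  under eq_bigr do rewrite subrK.
  rewrite sum_triple /eta_prod; apply: big1 => u _; apply: big1 => w _ /=; rewrite -mulr_sumr.
  by rewrite sum_eta // mulr0.
(* Expand the squares into pairs v, w in V and put w = d + v; after shifting c, every v contributes
   the same autocorrelation sum over d. *)
have sumS2 : \sum_c S c ^+ 2 = #|V|%:R * (qL * \sum_(d in V) nu d.1.1 * nu d.2).
  rewrite (eq_bigr (fun c => \sum_(v in V) \sum_(w in V) eta_prod (c + v) * eta_prod (c + w)));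
    last by move=> c _; rewrite expr2 mulr_suml; apply: eq_bigr => v _; rewrite mulr_sumr.
  rewrite exchange_big /= (eq_bigr (fun=> qL * \sum_(d in V) nu d.1.1 * nu d.2)).
    by rewrite sumr_const -[LHS]mulr_natl.
  move=> v vV; rewrite exchange_big /= mulr_sumr [LHS](reindex_inj (addIr v)) /=.
  apply: eq_big => [d|d dV]; first by rewrite addrC zmod_closed_addl.
  rewrite -eta_prod_autocorrelation [RHS](reindex_inj (addIr v)) /=.
  by apply: eq_bigr => c _; rewrite addrAC addrA.
have nuV : \sum_(d in V) nu d.1.1 * nu d.2 =
    q ^+ 2 * num_uz0 - q * num_u0 - q * num_z0 + #|V|%:R.
  rewrite /num_uz0 /num_u0 /num_z0 -!sum_indicator -sum1_card natr_sum.
  rewrite !mulr_sumr -!sumrB -big_split; apply: eq_bigr => d _ /=.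
  by rewrite !nuE -mulnb natrM; ring.
have V0 : 0 < #|V|%:R :> rat by rewrite ltr0n; apply/card_gt0P; exists 0; case: clV.
have PR : 1 < P%:R :> rat by rewrite ltr1n.
have cVR : #|V|%:R * P%:R = q * qL * q by rewrite -card_triple -cV natrM.
have T1 : \sum_(c | c \notin V) S c = - (#|V|%:R * S 0).
  move/eqP: sumS; rewrite (bigID (mem V)) /= (eq_bigr (fun=> S 0)) => [|c /SV //].
  by rewrite sumr_const -[X in X + _]mulr_natl addrC addr_eq0 => /eqP.
have T2 : \sum_(c | c \notin V) S c ^+ 2 = \sum_c S c ^+ 2 - #|V|%:R * S 0 ^+ 2.
  rewrite [\sum_c _](bigID (mem V)) /= [X in X + _ - _](eq_bigr (fun=> S 0 ^+ 2)).
    by rewrite sumr_const -[X in X + _ - _]mulr_natl addrAC subrr add0r.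
  by move=> c /SV ->.
have T0 : \sum_(c | c \notin V) 1 = #|V|%:R * (P%:R - 1) :> rat.
  rewrite mulrBr mulr1 -natrM cV -(cardsC V) natrD addrAC subrr add0r.
  by rewrite -sum1_card natr_sum; apply: eq_bigl => c; rewrite inE.
have CS := cauchy_schwarz_sum (fun c => c \notin V) S.
rewrite T0 T1 T2 sumS2 nuV in CS.
have -> : \sum_(v in V) eta_prod v = S 0 by apply: eq_bigr => v _; rewrite add0r.
exact: (coset_sum_bound V0 PR q_gt0 qL_gt0 cVR num_z0_ge num_u0_ge num_uz0_le CS).
Qed.

End SubgroupCounts.

(** The weight of the extremal subgroup for r <= m, where W has q/P elements; fa stands for f(a) and
    S for the total of f. *)
Definition low_weight (P fa S : rat) : rat :=
  qL * ((q - 1) * fa + (q / P - 1) * (S - fa)).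

(** * Upper bounds on the weight attained for r at most m *)

Section LowBounds.

Variables (V : {set X}) (P : nat) (A B : rat).
Hypotheses (clV : zmod_closed V) (P_gt0 : (0 < P)%N) (cV : (#|V| * P)%N = #|{: X}|).
Hypotheses (B_ge0 : 0 <= B) (B_le : B <= A).

Let PR_gt0 : 0 < P%:R :> rat. Proof. by rewrite ltr0n. Qed.

Let cardV : #|V|%:R = q * qL * q / P%:R :> rat.
Proof. by rewrite -card_triple -cV natrM mulfK ?gt_eqF. Qed.

(** In [wt_nu] both coefficients are nonnegative, so it suffices that the slice z = 0 has at least
    |V|/q elements and that u0 - uz0 <= (1 - 1/q) u0 with u0 <= q|L|. *)
Lemma wt_nu_low :
  wt (fun t => A + B * nu t) V <= low_weight P%:R (A + B * (q - 1)) (q * A).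
Proof.
rewrite wt_nu; have h1 := num_z0_ge clV; have h2 := num_uz0_ge clV; have h3 := num_u0_le V.
have -> : low_weight P%:R (A + B * (q - 1)) (q * A)
    = (A - B) * (#|V|%:R - #|V|%:R / q) + B * (q * (qL * q) - qL * q).
  by rewrite /low_weight cardV; field; rewrite !gt_eqF.
apply: lerD; first apply: ler_wpM2l; rewrite ?subr_ge0 //.
  by rewrite lerD2l lerN2 ler_pdivrMr // mulrC.
rewrite -mulrA; apply: ler_wpM2l => //; rewrite mulrBr.
have : (q - 1) * num_u0 V <= (q - 1) * (qL * q).
  by apply: ler_wpM2l => //; rewrite subr_ge0 ler1n; apply/card_gt0P; exists 0.
by lra.
Qed.

(** With the sign of B reversed, u0 - uz0 must be bounded from below: u0 is at least |V|/q and uz0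
    at most |L|. *)
Lemma wt_Nnu_low :
  wt (fun t => A - B * nu t) V <= low_weight P%:R (A + B) (q * A).
Proof.
rewrite (_ : wt _ V = wt (fun t => A + - B * nu t) V); last first.
  by apply: eq_bigr => v _; rewrite mulNr.
rewrite wt_nu; have h1 := num_z0_ge clV; have h2 := num_u0_ge clV; have h3 := num_uz0_le V.
have -> : low_weight P%:R (A + B) (q * A)
    = (A - - B) * (#|V|%:R - #|V|%:R / q) + - B * (#|V|%:R - q * qL).
  by rewrite /low_weight cardV; field; rewrite !gt_eqF.
have A_ge0 : 0 <= A by apply: le_trans B_le.
apply: lerD; first apply: ler_wpM2l; rewrite ?opprK ?addr_ge0 //.
  by rewrite lerD2l lerN2 ler_pdivrMr // mulrC.
rewrite -mulrA !mulNr lerN2; apply: ler_wpM2l => //; rewrite mulrBr.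
have : q * num_uz0 V <= q * qL by rewrite ler_pM2l.
by lra.
Qed.

(** Since eta(u/z) = eta(u) eta(z) and terms with z = 0 vanish, the character part is the sum of
    [eta_prod] over V with its first coordinate scaled by delta, again a subgroup of the same
    size. *)
Lemma wt_eta_low delta : odd #|K| -> delta != 0 -> (1 < P)%N ->
  wt (fun t => A + B * eta (delta * t)) V <= low_weight P%:R (A + B) (q * A).
Proof.
move=> oddK d0 P1; have h1 := num_z0_ge clV.
have -> : low_weight P%:R (A + B) (q * A)
    = A * (#|V|%:R - #|V|%:R / q) + B * (qL * q * (1 - P%:R^-1)).
  by rewrite /low_weight cardV; field; rewrite !gt_eqF.
have -> : wt (fun t => A + B * eta (delta * t)) V = A * (#|V|%:R - num_z0 V)
    + B * \sum_(v in V) eta (delta * v.1.1) * eta v.2.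
  rewrite /wt big_split /=; congr (_ + _).
    by rewrite -num_z_neq0 mulr_sumr; apply: eq_bigr => v _; rewrite mulr1.
  rewrite mulr_sumr [RHS](bigID (fun v : X => v.2 == 0)) /= [X in X + _]big1 ?add0r.
    apply: eq_bigr => v _; rewrite -(etaV oddK v.2) -!(etaM oddK).
    by rewrite !mulrA.
  by move=> v /andP[_ /eqP->]; rewrite eta0 !mulr0.
have A_ge0 : 0 <= A by apply: le_trans B_le.
apply: lerD; first apply: ler_wpM2l => //.
  by rewrite lerD2l lerN2 ler_pdivrMr // mulrC.
apply: ler_wpM2l => //.
have phiD : forall u v : X, (delta * (u - v).1.1, (u - v).1.2, (u - v).2)
   = (delta * u.1.1, u.1.2, u.2) - (delta * v.1.1, v.1.2, v.2) :> X.
  by move=> u v; congr (_, _, _); rewrite /= mulrBr.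
pose phi (v : X) : X := (delta * v.1.1, v.1.2, v.2).
have phi_inj : injective phi by move=> [[u w] z] [[u' w'] z'] [/(mulfI d0) -> -> ->].
rewrite (_ : \sum_(v in V) _ = \sum_(v in phi @: V) eta_prod v); last first.
  by rewrite big_imset //= => u v _ _; apply: phi_inj.
apply: eta_prod_sum_le => //; last by rewrite card_imset.
split; first by apply/imsetP; exists 0; [case: clV | rewrite /phi /= mulr0].
move=> _ _ /imsetP[u uV ->] /imsetP[v vV ->]; rewrite /phi -phiD.
by apply/imsetP; exists (u - v) => //; case: clV => _; apply.
Qed.

End LowBounds.

(** * Extremal subgroups and their weights *)

Section ExtremalSubgroup.

Variables (a : K) (W : {set K}) (W2 : {set L}) (W3 : {set K}).
Hypotheses (clW : zmod_closed W) (clW2 : zmod_closed W2) (clW3 : zmod_closed W3).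

Definition extremal : {set X} :=
  [set v | [&& v.1.1 - a * v.2 \in W, v.1.2 \in W2 & v.2 \in W3]].

Lemma extremal_closed : zmod_closed extremal.
Proof.
case: clW clW2 clW3 => [W0 WB] [W20 W2B] [W30 W3B].
split=> [|[[u w] z] [[u' w'] z']]; rewrite !inE /= ?mulr0 ?subr0 ?W0 ?W20 ?W30 //.
move=> /and3P[uW wW zW] /and3P[uW' wW' zW']; rewrite W2B // W3B // andbT andbT.
have subE (x x' y y' : K) : x - x' - a * (y - y') = (x - a * y) - (x' - a * y') by ring.
by rewrite subE WB.
Qed.

Lemma sum_extremal (F : X -> rat) :
  \sum_(v in extremal) F v =
  \sum_(u in W) \sum_(w in W2) \sum_(z in W3) F (u + a * z, w, z).
Proof.
rewrite (pair_big (mem W) (mem W2) (fun u w => \sum_(z in W3) F (u + a * z, w, z))) /=.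
rewrite (pair_big (fun uw : K * L => (uw.1 \in W) && (uw.2 \in W2)) (mem W3)
  (fun uw z => F (uw.1 + a * z, uw.2, z))) /=.
rewrite (reindex (fun v : X => (v.1.1 + a * v.2, v.1.2, v.2))) /=.
  by apply: eq_bigl => v; rewrite inE /= addrK andbA.
exists (fun v : X => (v.1.1 - a * v.2, v.1.2, v.2)) => -[[u w] z] _ /=.
  by rewrite addrK.
by rewrite subrK.
Qed.

Lemma card_extremal : #|extremal| = (#|W| * #|W2| * #|W3|)%N.
Proof.
have : #|extremal|%:R = (#|W| * #|W2| * #|W3|)%:R :> rat.
  rewrite -sum1_card natr_sum sum_extremal !sumr_const -!mulrnA.
  by congr (_ *+ _); ring.
by move/eqP; rewrite eqr_nat => /eqP.
Qed.

Lemma wt_extremal f : wt f extremal =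
  #|W2|%:R * \sum_(u in W) \sum_(z in W3 | z != 0) f (a + u / z).
Proof.
rewrite /wt big_mkcondr sum_extremal mulr_sumr; apply: eq_bigr => u _ /=.
rewrite sumr_const -[LHS]mulr_natl; congr (_ * _).
rewrite [RHS]big_mkcondr; apply: eq_bigr => z _ /=; case: eqP => //= /eqP z0.
by rewrite mulrDl mulfK // addrC.
Qed.

End ExtremalSubgroup.

(** The element 0 of W contributes f(a) for each nonzero z; for any other w in W, a + w/z runs once
    over all elements except a. *)
Lemma wt_extremal_low a (W : {set K}) f : 0 \in W ->
  wt f (extremal a W [set: L] [set: K]) =
  qL * ((q - 1) * f a + (#|W|%:R - 1) * (\sum_t f t - f a)).
Proof.
move=> W0; rewrite wt_extremal cardsT (bigD1 0) //=; congr (_ * (_ + _)).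
  rewrite (eq_bigr (fun=> f a)) => [|z _]; last by rewrite mul0r addr0.
  rewrite (_ : \sum_(z in _ | _) _ = \sum_(z in predC1 (0 : K)) f a); last first.
    by apply: eq_bigl => z; rewrite inE.
  rewrite sumr_const -[LHS]mulr_natl cardC1 -subn1 natrB //.
  by apply/card_gt0P; exists 0.
rewrite (eq_bigr (fun=> \sum_t f t - f a)) => [|w /andP[_ w0]]; last first.
  rewrite [X in X - _](bigD1 a) //= addrAC subrr add0r.
  rewrite [RHS](reindex_onto (fun z => a + w / z) (fun t => w / (t - a))) /=.
    apply: eq_bigl => z; rewrite inE /=; have -> : a + w / z - a = w / z by ring.
    rewrite -[a + w / z == a]subr_eq0 (_ : a + w / z - a = w / z); last by ring.
    have [->|z0] := eqVneq z 0; first by rewrite invr0 !mulr0 eqxx.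
    by rewrite mulf_neq0 ?invr_eq0 //= invf_div mulrC divfK ?eqxx.
  by move=> t ta; rewrite invf_div mulrC divfK ?subr_eq0 // addrC subrK.
rewrite (_ : \sum_(i in W | i != 0) _ = \sum_(i in W :\ 0) (\sum_t f t - f a)); last first.
  by apply: eq_bigl => w; rewrite !inE andbC.
by rewrite sumr_const -[LHS]mulr_natl (cardsD1 0 W) W0 natrD addrAC subrr add0r.
Qed.

Lemma wt_extremal_line a (W2 : {set L}) (W3 : {set K}) f : 0 \in W3 ->
  wt f (extremal a [set 0] W2 W3) = #|W2|%:R * (#|W3|%:R - 1) * f a.
Proof.
move=> W30; rewrite wt_extremal big_set1 -mulrA; congr (_ * _).
rewrite (eq_bigr (fun=> f a)) => [|z _]; last by rewrite mul0r addr0.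
rewrite (_ : \sum_(z in _ | _) _ = \sum_(z in W3 :\ 0) f a); last first.
  by apply: eq_bigl => z; rewrite !inE andbC.
by rewrite sumr_const -[LHS]mulr_natl (cardsD1 0 W3) W30 natrD addrAC subrr add0r.
Qed.

(** * The maximal weight in the three ranges of r *)

Section MaximalWeight.

Variables (p m m2 r : nat) (f : K -> rat) (a : K).
Hypotheses (pr_p : prime p) (cardK : #|K| = (p ^ m)%N) (cardL : #|L| = (p ^ (m * m2))%N).
Hypotheses (f_le : forall t, f t <= f a) (fa_ge0 : 0 <= f a).
Hypothesis r_range : (1 <= r <= m * (m2 + 2))%N.
Hypothesis low_bound : (r <= m)%N -> forall V : {set X}, zmod_closed V ->
  (#|V| * p ^ r = #|{: X}|)%N -> wt f V <= low_weight (p ^ r)%:R (f a) (\sum_t f t).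

Let P_gt0 : 0 < (p ^ r)%:R :> rat. Proof. by rewrite ltr0n expn_gt0 prime_gt0. Qed.

(** As r grows the extremal subgroup shrinks first in W, then in W2, then in W3; each case covers
    one of these stages. *)
Definition max_weight : rat :=
  if (r <= m)%N then low_weight (p ^ r)%:R (f a) (\sum_t f t)
  else if (r <= m * (m2 + 1))%N then q * qL / (p ^ r)%:R * (q - 1) * f a
  else (q * qL * q / (p ^ r)%:R - 1) * f a.

Lemma max_weightP : exists V : {set X}, [/\ zmod_closed V, (#|V| * p ^ r = #|{: X}|)%N,
  wt f V = max_weight & forall V' : {set X}, zmod_closed V' ->
    (#|V'| * p ^ r = #|{: X}|)%N -> wt f V' <= max_weight].
Proof.
have cX : #|{: X}| = (p ^ (m * (m2 + 2)))%N.
  by rewrite !card_prod cardK cardL -!expnD; congr (_ ^ _)%N; lia.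
have cTK := zmod_closed_setT K; have cTL := zmod_closed_setT L.
have c0K := zmod_closed_set0 K; have c0L := zmod_closed_set0 L.
have cVR (V : {set X}) : (#|V| * p ^ r = #|{: X}|)%N -> #|V|%:R = q * qL * q / (p ^ r)%:R :> rat.
  by move=> cV; rewrite -card_triple -cV natrM mulfK ?gt_eqF.
have divP i j : (i = j + r)%N -> (p ^ j)%:R = (p ^ i)%:R / (p ^ r)%:R :> rat.
  by move=> ->; rewrite expnD natrM mulfK ?gt_eqF.
rewrite /max_weight; case: leqP => [r_le|r_gt].
  have [W clW cW] := exists_zmod_closed pr_p cardK (leq_subr r m).
  exists (extremal a W setT setT); split.
  - exact: extremal_closed.
  - rewrite card_extremal !cardsT cW cardK cardL cX -!expnD; congr (_ ^ _)%N; lia.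
  - rewrite wt_extremal_low; last by case: clW.
    by rewrite cW (divP m (m - r)%N) ?subnK // -cardK.
  - exact: low_bound.
case: leqP => [r_le|{}r_gt].
  have [W clW cW] := exists_zmod_closed (j := m * (m2 + 1) - r) pr_p cardL ltac:(lia).
  exists (extremal a [set 0] W setT); split.
  - exact: extremal_closed.
  - rewrite card_extremal cards1 cardsT cW cardK cX mul1n -!expnD; congr (_ ^ _)%N; lia.
  - rewrite wt_extremal_line ?in_setT // cW cardsT (divP (m + m * m2)%N (m * (m2 + 1) - r)%N ltac:(lia)).
    by rewrite expnD natrM -cardK -cardL.
  (* Each term is at most f(a), and at least |V|/q elements have z = 0. *)
  - move=> V clV cV; apply: le_trans (wt_le _ f_le) _.
    have -> : q * qL / (p ^ r)%:R * (q - 1) * f a = f a * (#|V|%:R - #|V|%:R / q).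
      by rewrite cVR //; field; rewrite !gt_eqF.
    apply: ler_wpM2l => //; rewrite lerD2l lerN2 ler_pdivrMr // mulrC.
    exact: num_z0_ge.
have [W clW cW] := exists_zmod_closed (j := m * (m2 + 2) - r) pr_p cardK ltac:(lia).
exists (extremal a [set 0] [set 0] W); split.
- exact: extremal_closed.
- rewrite card_extremal !cards1 cW cX !mul1n -!expnD; congr (_ ^ _)%N; lia.
- rewrite wt_extremal_line; last by case: clW.
  rewrite cW cards1 mul1r (divP (m * (m2 + 2))%N (m * (m2 + 2) - r)%N ltac:(lia)).
  by rewrite -cX card_triple.
(* Now |V| < q, so the trivial bound 1 on the number of elements with z = 0 beats |V|/q. *)
move=> V clV cV; apply: le_trans (wt_le _ f_le) _.
rewrite mulrC -(cVR V cV); apply: ler_wpM2r => //; rewrite lerD2l lerN2.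
exact: num_z0_ge1.
Qed.

End MaximalWeight.

End WeightBounds.

(** * Fibres of a diagonal form and generalized Hamming weights *)

Section DiagonalForm.

Variables (p m m1 : nat) (K L : finFieldType) (Q : L -> K) (g : {ffun 'I_m1 -> K} -> L).
Variables (lam : 'I_m1 -> K) (rQ : nat).
Hypotheses (pr_p : prime p) (odd_p : odd p) (cardK : #|K| = (p ^ m)%N).
Hypotheses (g_bij : bijective g) (rQ_le : (rQ <= m1)%N) (m1_gt0 : (0 < m1)%N).
Hypotheses (lam_neq0 : forall i : 'I_m1, (i < rQ)%N -> lam i != 0)
  (Qg : forall c : {ffun 'I_m1 -> K}, Q (g c) = \sum_(i < m1 | (i < rQ)%N) lam i * c i ^+ 2).

Local Notation q := (#|K|%:R : rat).

Let oddK : odd #|K|. Proof. by rewrite cardK oddX odd_p orbT. Qed.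

Let q_neq0 : q != 0. Proof. exact: natr_card_neq0. Qed.

(** Extension by zero to all indices, which turns the coordinates beyond the rank into free
    variables. *)
Definition diag_coef (k : nat) : K :=
  if (insub k : option 'I_m1) is Some i then if (i < rQ)%N then lam i else 0 else 0.

Lemma diag_coefE (i : 'I_m1) : diag_coef i = if (i < rQ)%N then lam i else 0.
Proof. by rewrite /diag_coef valK. Qed.

Lemma diag_coef_neq0 k : (k < rQ)%N -> diag_coef k != 0.
Proof.
move=> kr; have km : (k < m1)%N by apply: leq_trans rQ_le.
by rewrite (diag_coefE (Ordinal km)) /= kr lam_neq0.
Qed.

Lemma diag_coef_eq0 k : (rQ <= k)%N -> diag_coef k = 0.
Proof. by rewrite /diag_coef; case: insubP => // i _ -> rk; rewrite ltnNge rk. Qed.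

Lemma prod_diag_coef : \prod_(i < rQ) diag_coef i = \prod_(i < m1 | (i < rQ)%N) lam i.
Proof.
rewrite (big_ord_widen _ _ rQ_le); apply: eq_bigr => i ir.
by rewrite diag_coefE ir.
Qed.

Lemma fiber_nsol t : (fiber Q t)%:R = q ^+ (m1 - rQ) * nsol rQ diag_coef t.
Proof.
rewrite -nsol_degenerate; last exact: diag_coef_eq0.
rewrite subnKC // /nsol; congr (_ %:R); rewrite /fiber -(card_imset _ (bij_inj g_bij)).
have [h gK hK] := g_bij; apply: eq_card => x; rewrite inE; apply/eqP/imsetP => [Qx|[c]].
  exists (h x); rewrite ?hK // inE -Qx -{2}(hK x) Qg; apply/eqP.
  rewrite [RHS]big_mkcond; apply: eq_bigr => i _; rewrite diag_coefE.
  by case: ifP; rewrite ?mul0r.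
rewrite inE => /eqP <- ->; rewrite Qg big_mkcond; apply: eq_bigr => i _.
by rewrite diag_coefE; case: ifP; rewrite ?mul0r.
Qed.

(** The average fibre size q^(m1-1) is factored out: for rQ = 2k+1 the character term has
    q^(m1-rQ+k) = q^(m1-1) q^(-k). *)
Lemma fiber_odd t : odd rQ -> (fiber Q t)%:R =
  q ^+ m1.-1 + q ^+ m1.-1 * q ^- (rQ.-1 %/ 2) * eta (disc diag_coef rQ * t).
Proof.
move=> orQ; rewrite fiber_nsol (nsol_nondeg oddK) ?orQ; last exact: diag_coef_neq0.
have rE : rQ = (rQ.-1 %/ 2).*2.+1.
  rewrite divn2; move: orQ; case: (rQ) => [//|k] /= ek.
  by rewrite -{1}(odd_double_half k) (negPf ek).
have -> : (rQ %/ 2 = rQ.-1 %/ 2)%N by rewrite [in LHS]rE divn2 /= uphalf_double.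
set k := (rQ.-1 %/ 2)%N in rE *; rewrite mulrDr -exprD mulrA -exprD; congr (_ ^+ _ + _ * _).
  by rewrite rE; lia.
have -> : m1.-1 = (m1 - rQ + k + k)%N by rewrite -addnn in rE; lia.
by rewrite [in RHS]exprD mulfK // expf_neq0.
Qed.

Lemma fiber_even t : ~~ odd rQ -> (fiber Q t)%:R =
  q ^+ m1.-1 + q ^+ m1.-1 * q ^- (rQ %/ 2) * eta (disc diag_coef rQ) * nu t.
Proof.
move=> erQ; rewrite fiber_nsol (nsol_nondeg oddK) ?(negPf erQ); last exact: diag_coef_neq0.
have rE : rQ = (rQ %/ 2).*2.
  by rewrite divn2 -{1}(odd_double_half rQ) (negPf erQ).
set k := (rQ %/ 2)%N in rE *.
have e1 : q ^+ (m1 - rQ) * q ^+ rQ = q ^+ m1.-1 * q by rewrite -exprD subnK // -exprSr prednK.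
have e2 : q ^+ (m1 - rQ) * q ^+ k = q ^+ m1.-1 * q / q ^+ k.
  rewrite -exprSr prednK // -exprD.
  have m1E : m1 = (m1 - rQ + k + k)%N by rewrite -addnn in rE; lia.
  by rewrite [in RHS]m1E [in RHS]exprD mulfK ?expf_neq0.
rewrite mulrA mulrDr e1 !mulrA e2; field.
by rewrite q_neq0 expf_neq0.
Qed.

Lemma qchar_exp (x : K) k : qchar (x ^+ k) = qchar x ^+ k.
Proof.
elim: k => [|k IHk]; last by rewrite !exprS qcharM // IHk.
rewrite /qchar expr0 oner_eq0; case: existsP => // -[]; exists 1; rewrite expr1n //.
Qed.

(** The exponent of -1 is (q-1)/2 times rQ/2. Here (q-1)/2 is (p-1)/2 times 1 + p + ... + p^(m-1), a
    sum of m odd terms and so congruent to m modulo 2. *)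
Lemma qchar_disc : ~~ odd rQ -> qchar (disc diag_coef rQ) =
  qchar (\prod_(i < m1 | (i < rQ)%N) lam i) * (-1) ^+ ((p.-1 * m * rQ) %/ 4).
Proof.
move=> erQ; rewrite /disc prod_diag_coef qcharM // mulrC qchar_exp qcharN1 // -exprM cardK.
congr (_ * _); have p_gt1 := prime_gt1 pr_p.
have p_half : p.-1 = (p.-1 %/ 2 * 2)%N.
  by rewrite divnK // dvdn2 -subn1 oddB ?odd_p // ltnW.
have r_half : rQ = (rQ %/ 2 * 2)%N by rewrite divnK // dvdn2.
rewrite predn_exp [in X in (X * _ %/ 2)%N]p_half mulnAC mulnK //.
have -> : (p.-1 * m * rQ %/ 4 = p.-1 %/ 2 * m * (rQ %/ 2))%N.
  by rewrite {1}p_half {1}r_half -(mulnK (p.-1 %/ 2 * m * (rQ %/ 2)) (ltn0Sn 3)); congr (_ %/ _)%N; lia.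
have odd_sum : odd (\sum_(i < m) p ^ i)%N = odd m.
  elim: m => [|k IHk]; first by rewrite big_ord0.
  by rewrite big_ord_recr /= oddD IHk oddX odd_p orbT addbT.
by rewrite -[LHS]signr_odd -[RHS]signr_odd !oddM odd_sum.
Qed.

End DiagonalForm.

(** * Generalized Hamming weights from the largest fibre *)

Section GeneralizedWeights.

Variables (p m m1 m2 N r : nat) (K L1 L2 : finFieldType) (iota : {rmorphism K -> L2})
  (theta : K) (Q : L1 -> K).
Hypotheses (pK : p \in [pchar K]) (m_gt0 : (0 < m)%N) (m1_gt0 : (0 < m1)%N) (m2_gt0 : (0 < m2)%N)
  (cardK : #|K| = (p ^ m)%N) (cardL1 : #|L1| = ((p ^ m) ^ m1)%N)
  (cardL2 : #|L2| = ((p ^ m) ^ m2)%N)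
  (N_gt0 : (0 < N)%N) (N_dvd : (N %| p.-1)%N)
  (coN : coprime N ((p ^ m).-1 %/ p.-1))
  (prim_theta : ((p ^ m).-1 %/ N).-primitive_root theta)
  (Q0 : Q 0 = 0) (Qnz : exists x, Q x != 0) (r_range : (1 <= r <= m * (m2 + 2))%N).

Local Notation q := ((p ^ m)%:R : rat).
Local Notation P := ((p ^ r)%:R : rat).
Local Notation C := (@desc_code p m m2 ((p ^ m).-1 %/ N) K L1 L2 iota Q theta).

Let pr_p : prime p. Proof. exact: pcharf_prime pK. Qed.

(* c is the relative excess of the largest fibre of Q over the average q^(m1-1). *)
Lemma ghw_of_fibers (a : K) (c : rat) :
  (forall t, (fiber Q t <= fiber Q a)%N) -> (fiber Q a)%:R = q ^+ m1.-1 * (1 + c) ->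
  (forall V : {set K * L2 * K}, zmod_closed V -> (#|V| * p ^ r = #|{: K * L2 * K}|)%N ->
    wt (fun t => (fiber Q t)%:R) V
      <= low_weight K L2 P (q ^+ m1.-1 * (1 + c)) (q * q ^+ m1.-1)) ->
  [/\ (r <= m)%N -> ghw_eq C r (q ^+ (m1 + m2) / (P * N%:R)
        * (P - 1) * (q - 1 - c)),
      (m < r <= m * (m2 + 1))%N -> ghw_eq C r (q ^+ (m1 + m2) * (q - 1) / (P * N%:R)
        * (P - 1 - c)) &
      (m * (m2 + 1) < r)%N -> ghw_eq C r (q ^+ (m1 + m2) / (P * N%:R)
        * (P * (q - 1) - (q - (p ^ (r - m * (m2 + 1)))%:R) * (1 + c)))].
Proof.
move=> f_le fa low.
have cK : (#|K|%:R : rat) = q by rewrite cardK.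
have cL : (#|L2|%:R : rat) = q ^+ m2 by rewrite cardL2 natrX.
have q_gt0 : 0 < q by rewrite ltr0n expn_gt0 prime_gt0.
have P_gt0 : 0 < P by rewrite ltr0n expn_gt0 prime_gt0.
have N0 : N%:R != 0 :> rat by rewrite pnatr_eq0 -lt0n.
have sumf : \sum_t (fiber Q t)%:R = q * q ^+ m1.-1 :> rat.
  rewrite -exprS prednK // -natrX -cardL1 -natr_sum; congr (_ %:R).
  rewrite -[RHS]sum1_card (partition_big Q xpredT) //=; apply: eq_bigr => t _.
  by rewrite sum1dep_card.
have cardL2' : #|L2| = (p ^ (m * m2))%N by rewrite cardL2 -expnM.
have [V [clV cV wV maxV]] := @max_weightP K L2 p m m2 r (fun t => (fiber Q t)%:R) a pr_p cardK cardL2'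
  (fun t => ltac:(by rewrite ler_nat)) (ler0n _ _) r_range
  (fun _ V clV cV => ltac:(by rewrite /= fa sumf; apply: low)).
have wtE (V' : {set K * L2 * K}) : (weight Q V')%:R = wt (fun t => (fiber Q t)%:R) V' :> rat.
  by rewrite /weight natr_sum.
have cardL2K : #|L2| = (#|K| ^ m2)%N by rewrite cardK.
have main x : x * N%:R = q ^+ (m1 + m2) * (q - 1)
    - max_weight L2 p m m2 r (fun t => (fiber Q t)%:R) a -> ghw_eq C r x.
  move=> xE; apply: (ghw_of_max_weight iota pK m_gt0 m2_gt0 cardK cardL2K N_gt0 N_dvd coN prim_theta Q0 Qnz clV cV).
    by move=> V' clV' cV'; rewrite -(ler_nat rat) !wtE wV maxV.
  rewrite xE wtE wV cardL1 cardL2 !natrM exprD !natrX -subn1 natrB ?natrX //.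
  by rewrite expn_gt0 prime_gt0.
have qm : q ^+ (m1 + m2) = q * q ^+ m1.-1 * q ^+ m2 by rewrite -exprS prednK // -exprD.
split=> hr; apply: main; rewrite /max_weight ?hr.
- rewrite /low_weight /= cK cL fa sumf qm; field; rewrite N0 !gt_eqF //.
- have [mr r_le] := andP hr; rewrite leqNgt mr r_le /= cK cL fa qm; field.
  by rewrite N0 gt_eqF.
rewrite leqNgt (leq_ltn_trans _ hr) /=; last by rewrite leq_pmulr ?addn1.
rewrite leqNgt hr /= cK cL fa qm.
(* In this range P contains the factor q^(m2+1), so |V| = q^(m2+2)/P becomes q / p^(r - m(m2+1)). *)
have -> : P = (p ^ (r - m * (m2 + 1)))%:R * (q * q ^+ m2).
  rewrite -exprS -natrX -natrM -expnM -expnD -(addn1 m2).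
  by rewrite subnK // ltnW.
have q_neq0 := lt0r_neq0 q_gt0.
by field; rewrite N0 q_neq0 expf_neq0 // pnatr_eq0 -lt0n expn_gt0 prime_gt0.
Qed.

End GeneralizedWeights.

Theorem theorem6
  (p m m1 m2 N : nat) (K L1 L2 : finFieldType)
  (iota1 : {rmorphism K -> L1}) (iota2 : {rmorphism K -> L2})
  (theta : K) (Q : L1 -> K)
  (e : 'I_m1 -> L1) (lam : 'I_m1 -> K) (rQ : nat) :
  prime p -> odd p -> (0 < m)%N -> (0 < m1)%N -> (0 < m2)%N ->
  #|K| = (p ^ m)%N -> p \in [pchar K] ->
  #|L1| = ((p ^ m) ^ m1)%N -> #|L2| = ((p ^ m) ^ m2)%N ->
  (0 < N)%N -> (N %| p.-1)%N -> coprime N ((p ^ m).-1 %/ p.-1) ->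
  ((p ^ m).-1 %/ N).-primitive_root theta ->
  (* Q is a nonzero quadratic form on F_{q1}/F_q *)
  is_quadratic_form iota1 Q -> (exists x, Q x != 0) ->
  (* coordinates (basis e) in which Q = sum_{i < rQ} lam_i x_i^2 *)
  bijective (fun c : {ffun 'I_m1 -> K} => \sum_(i < m1) iota1 (c i) * e i) ->
  (rQ <= m1)%N -> (forall i : 'I_m1, (i < rQ)%N -> lam i != 0) ->
  (forall c : {ffun 'I_m1 -> K},
      Q (\sum_(i < m1) iota1 (c i) * e i)
        = \sum_(i < m1 | (i < rQ)%N) lam i * c i ^+ 2) ->
  let q : rat := (p ^ m)%:R in
  let M := (m1 + m2)%N in
  let eta_Q := qchar (\prod_(i < m1 | (i < rQ)%N) lam i) in
  let eps : int := if ~~ odd rQ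
                   then eta_Q * (-1) ^+ ((p.-1 * m * rQ) %/ 4)
                   else eta_Q * (-1) ^+ ((p.-1 * m * rQ.+1) %/ 4) in
  let C := @desc_code p m m2 ((p ^ m).-1 %/ N) K L1 L2 iota2 Q theta in
  let pr (r : nat) : rat := (p ^ r)%:R in
  let Nr : rat := N%:R in
  forall r : nat, (1 <= r <= m * (m2 + 2))%N ->
  [/\
   (* (1) rQ even, eps = 1 *)
   (~~ odd rQ -> eps = 1 ->
     [/\ (r <= m)%N ->
           ghw_eq C r (q ^+ M * (q - 1) / (pr r * Nr) * (pr r - 1)
                         * (1 - q ^- (rQ %/ 2))),
         (m < r <= m * (m2 + 1))%N ->
           ghw_eq C r (q ^+ M * (q - 1) / (pr r * Nr)
                         * (pr r - 1 - q ^- (rQ %/ 2) * (q - 1))) &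
         (m * (m2 + 1) < r)%N ->
           ghw_eq C r (q ^+ M / (pr r * Nr)
                         * (pr r * (q - 1) - (q - pr (r - m * (m2 + 1))%N)
                              * (1 + q ^- (rQ %/ 2) * (q - 1))))]),
   (* (2) rQ even, eps = -1 *)
   (~~ odd rQ -> eps = -1 ->
     [/\ (r <= m)%N ->
           ghw_eq C r (q ^+ M / (pr r * Nr) * (pr r - 1)
                         * (q - 1 - q ^- (rQ %/ 2))),
         (m < r <= m * (m2 + 1))%N ->
           ghw_eq C r (q ^+ M * (q - 1) / (pr r * Nr)
                         * (pr r - 1 - q ^- (rQ %/ 2))) &
         (m * (m2 + 1) < r)%N ->
           ghw_eq C r (q ^+ M / (pr r * Nr)
                         * (pr r * (q - 1) - (q - pr (r - m * (m2 + 1))%N)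
                              * (1 + q ^- (rQ %/ 2))))]) &
   (* (3) rQ odd *)
   (odd rQ ->
     [/\ (r <= m)%N ->
           ghw_eq C r (q ^+ M / (pr r * Nr) * (pr r - 1)
                         * (q - 1 - q ^- (rQ.-1 %/ 2))),
         (m < r <= m * (m2 + 1))%N ->
           ghw_eq C r (q ^+ M * (q - 1) / (pr r * Nr)
                         * (pr r - 1 - q ^- (rQ.-1 %/ 2))) &
         (m * (m2 + 1) < r)%N ->
           ghw_eq C r (q ^+ M / (pr r * Nr)
                         * (pr r * (q - 1) - (q - pr (r - m * (m2 + 1))%N)
                              * (1 + q ^- (rQ.-1 %/ 2))))])].
Proof.
move=> pr_p odd_p m_gt0 m1_gt0 m2_gt0 cardK pK cardL1 cardL2 N_gt0 N_dvd coN prim_theta.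
move=> [QZ _] Qnz g_bij rQ_le lam_neq0 Qg q M eta_Q eps C pr Nr r r_range.
have Q0 : Q 0 = 0 by have := QZ 0 0; rewrite rmorph0 mul0r expr2 !mul0r.
have cK : (#|K|%:R : rat) = q by rewrite cardK.
have oddK : odd #|K| by rewrite cardK oddX odd_p orbT.
have q_gt1 : 1 < q by rewrite ltr1n -(expn0 p) ltn_exp2l // prime_gt1.
have q_gt0 : 0 < q by apply: lt_trans q_gt1.
have P_gt1 : (1 < p ^ r)%N by rewrite -(expn0 p) ltn_exp2l ?prime_gt1 //; case/andP: r_range.
pose A := q ^+ m1.-1; have A_ge0 : 0 <= A by rewrite exprn_ge0 // ltW.
(* Supplies 0 <= B <= A, as required by the bounds for r <= m. *)
have y_bound k : 0 <= A * q ^- k <= A.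
  rewrite mulr_ge0 ?invr_ge0 ?exprn_ge0 ?(ltW q_gt0) //= -[leRHS]mulr1.
  by apply: ler_wpM2l => //; rewrite invf_le1 ?exprn_gt0 // exprn_ege1 // ltW.
have nu_le (t : K) : nu t <= q - 1.
  by rewrite /nu cK; case: eqP => // _; rewrite lerBrDr addNr ltW.
have nu_ge (t : K) : -1 <= nu t.
  by rewrite /nu cK; case: eqP => // _; rewrite lerBrDr addNr ltW.
have fodd := fiber_odd pr_p odd_p cardK g_bij rQ_le m1_gt0 lam_neq0 Qg.
have feven := fiber_even pr_p odd_p cardK g_bij rQ_le m1_gt0 lam_neq0 Qg.
rewrite cK -/A in fodd feven.
have ghw := @ghw_of_fibers p m m1 m2 N r K L1 L2 iota2 theta Q pK m_gt0 m1_gt0 m2_gt0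
  cardK cardL1 cardL2 N_gt0 N_dvd coN prim_theta Q0 Qnz r_range.
set D := disc _ _ in fodd feven.
have etaD : ~~ odd rQ -> eta D = eps%:~R.
  by move=> erQ; rewrite /eta (qchar_disc lam pr_p odd_p cardK rQ_le) // /eps erQ.
have D_neq0 : D != 0.
  rewrite mulf_neq0 ?expf_neq0 ?oppr_eq0 ?oner_eq0 //.
  by apply/prodf_neq0 => i _; apply: diag_coef_neq0.
split=> [erQ eps1|erQ epsN1|orQ].
- have fE t : (fiber Q t)%:R = A + A * q ^- (rQ %/ 2) * nu t.
    by rewrite feven // etaD // eps1 mulr1.
  have /andP[B0 BA] := y_bound (rQ %/ 2)%N.
  have nu0 : nu (0 : K) = q - 1 by rewrite /nu eqxx cK.
  (* With eta(D) = 1 the largest fibre lies over 0, where nu is q - 1. *)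
  have [] := ghw 0 (q ^- (rQ %/ 2) * (q - 1)).
  + by move=> t; rewrite -(ler_nat rat) !fE lerD2l ler_wpM2l // nu0.
  + by rewrite fE nu0 -/A; ring.
  + move=> V clV cV; rewrite (_ : wt _ V = wt (fun t => A + A * q ^- (rQ %/ 2) * nu t) V).
      have := wt_nu_low clV (ltnW P_gt1) cV B0 BA; rewrite cK => /le_trans; apply.
      by rewrite -/A le_eqVlt; apply/orP; left; apply/eqP; congr (low_weight _ _ _ _ _); ring.
    by apply: eq_bigr => v _; rewrite fE.
  move=> low mid high; split=> hr.
  + by apply: (eq_ind _ (ghw_eq C r) (low hr)); rewrite /pr /Nr /M -/q; ring.
  + by apply: (eq_ind _ (ghw_eq C r) (mid hr)).
  + by apply: (eq_ind _ (ghw_eq C r) (high hr)).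
- have fE t : (fiber Q t)%:R = A - A * q ^- (rQ %/ 2) * nu t.
    by rewrite feven // etaD // epsN1 mulrN1z mulrN1 mulNr.
  have /andP[B0 BA] := y_bound (rQ %/ 2)%N.
  have nu1 : nu (1 : K) = -1 by rewrite /nu oner_eq0.
  (* With eta(D) = -1 all fibres over nonzero t share the largest size; 1 represents them. *)
  have [] := ghw 1 (q ^- (rQ %/ 2)).
  + by move=> t; rewrite -(ler_nat rat) !fE lerD2l lerN2 ler_wpM2l // nu1.
  + by rewrite fE nu1 -/A; ring.
  + move=> V clV cV; rewrite (_ : wt _ V = wt (fun t => A - A * q ^- (rQ %/ 2) * nu t) V).
      have := wt_Nnu_low clV (ltnW P_gt1) cV B0 BA; rewrite cK => /le_trans; apply.
      by rewrite -/A le_eqVlt; apply/orP; left; apply/eqP; congr (low_weight _ _ _ _ _); ring.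
    by apply: eq_bigr => v _; rewrite fE.
  move=> low mid high; split=> hr.
  + by apply: (eq_ind _ (ghw_eq C r) (low hr)); rewrite /pr /Nr /M -/q; ring.
  + by apply: (eq_ind _ (ghw_eq C r) (mid hr)).
  + by apply: (eq_ind _ (ghw_eq C r) (high hr)).
- have fE t : (fiber Q t)%:R = A + A * q ^- (rQ.-1 %/ 2) * eta (D * t) by exact: fodd.
  have /andP[B0 BA] := y_bound (rQ.-1 %/ 2)%N.
  have eta_le (t : K) : eta t <= 1 by rewrite /eta; case: (qcharP t) => ->.
  have etaDD : eta (D * D) = 1 by rewrite -expr2 eta_sqr.
  (* The largest fibres lie over the t with eta(D t) = 1, and t = D is one of them. *)
  have [] := ghw D (q ^- (rQ.-1 %/ 2)).
  + by move=> t; rewrite -(ler_nat rat) !fE lerD2l ler_wpM2l // etaDD.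
  + by rewrite fE etaDD -/A; ring.
  + move=> V clV cV; rewrite (_ : wt _ V = wt (fun t => A + A * q ^- (rQ.-1 %/ 2) * eta (D * t)) V).
      have := wt_eta_low clV (ltnW P_gt1) cV B0 BA oddK D_neq0 P_gt1; rewrite cK => /le_trans; apply.
      by rewrite -/A le_eqVlt; apply/orP; left; apply/eqP; congr (low_weight _ _ _ _ _); ring.
    by apply: eq_bigr => v _; rewrite fE.
  move=> low mid high; split=> hr.
  + by apply: (eq_ind _ (ghw_eq C r) (low hr)); rewrite /pr /Nr /M -/q; ring.
  + by apply: (eq_ind _ (ghw_eq C r) (mid hr)).
  + by apply: (eq_ind _ (ghw_eq C r) (high hr)).
Qed.
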